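(* Let $\Phi:\bar M\to N$ be an immersion of degree $d$ of an $m$-dimensional manifold into an equiregular graded manifold $N$, and let $g$ and $\tilde g$ be two Riemannian metrics on $N$. Then a vector field $V\in\mathfrak X_0(\bar M,N)$ is admissible with respect to $g$ if and only if $V$ is admissible with respect to $\tilde g$.
   Context: **Graded manifolds and degree.** A graded manifold $(N,(\mathcal H^i))$ is a smooth $n$-manifold with a flag of sub-bundles $\mathcal H^1\subset\mathcal H^2\subset\cdots\subset TN$ with $[\mathcal H^i,\mathcal H^j]\subset\mathcal H^{i+j}$, $\bigcup_i\mathcal H^i=TN$, and $\mathcal H^s_p=T_pN$ for some $s=s(p)$ at each $p$; it is equiregular if all $n_i=\dim\mathcal H^i_p$ are constant ($n_0=0$). A local frame $(X_1,\dots,X_n)$ is adapted if $X_1,\dots,X_{n_i}$ span $\mathcal H^i$ for each $i$; then $\deg X_j=i$ for $n_{i-1}<j\le n_i$. For $J=(j_1<\dots<j_m)$, $X_J=X_{j_1}\wedge\dots\wedge X_{j_m}$, $\deg X_J=\sum_i\deg X_{j_i}$. The degree of an $m$-vector $\sum\lambda_JX_J$ is $\max\{\deg X_J:\lambda_J\ne0\}$. The degree $d$ of an immersion is the maximum over its points of the degree of $e_1\wedge\dots\wedge e_m$, $(e_i)$ a basis of the tangent space. **Admissible vector fields.** $\mathfrak X_0(\bar M,N)$ is the set of smooth compactly supported maps $V:\bar M\to TN$ with $V(\bar p)\in T_{\Phi(\bar p)}N$. Given a Riemannian metric $g=\langle\cdot,\cdot\rangle$ on $N$, extended to $m$-vectors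 by $\langle v_1\wedge\dots\wedge v_m,w_1\wedge\dots\wedge w_m\rangle=\det(\langle v_i,w_j\rangle)$, the field $V$ is admissible with respect to $g$ if at each $p=\Phi(\bar p)$, for a local $g$-orthonormal adapted frame $(X_i)$ and a basis $e_j=d\Phi_{\bar p}(\bar e_j)$ of $d\Phi_{\bar p}(T_{\bar p}\bar M)$, $$0=\langle e_1\wedge\dots\wedge e_m,\nabla_{V}X_J\rangle+\sum_{k=1}^m\langle e_1\wedge\dots\wedge\overset{(k)}{\nabla_{e_k}V}\wedge\dots\wedge e_m,X_J\rangle\quad\text{for all }J\text{ with }\deg(X_J)>d,$$ where $\nabla$ is the Levi-Civita connection of $g$ and the induced covariant derivative along $\Phi$. *)

(* Defs.v *)
From HB Require Import structures.
From mathcomp Require Import all_boot all_order all_algebra.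
From mathcomp Require Import all_classical all_reals all_analysis.
Export numFieldNormedType.Exports.

Set Implicit Arguments.
Unset Strict Implicit.
Unset Printing Implicit Defensive.

Import Order.TTheory GRing.Theory Num.Theory.
Local Open Scope classical_set_scope.
Local Open Scope ring_scope.

(* The functions below are total; [A] is always an open set, outside of which
   the values of [f] are irrelevant. *)
Fixpoint Ck_on (R : realType) (n : nat) (W : normedModType R) (k : nat)
    (A : set 'rV[R]_n) (f : 'rV[R]_n -> W) : Prop :=
  match k with
  | 0%N => forall x, A x -> {for x, continuous f}
  | k'.+1 => (forall x, A x -> differentiable f x) /\
             (forall v, Ck_on k' A (fun x => 'D_v f x))
  end.

Definition smooth_on (R : realType) (n : nat) (W : normedModType R)
    (A : set 'rV[R]_n) (f : 'rV[R]_n -> W) : Prop :=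
  forall k, Ck_on k A f.

Record chart (R : realType) (n : nat) (T : topologicalType) := Chart {
  cdom : set T;
  cmap : T -> 'rV[R]_n;
  cinv : 'rV[R]_n -> T;
  cdom_open : open cdom;
  cimg_open : open (cmap @` cdom);
  cmapK : forall p, cdom p -> cinv (cmap p) = p;
  cmap_continuous : forall p, cdom p -> {for p, continuous cmap};
  cinv_continuous :
    forall x, (cmap @` cdom) x -> {for x, continuous cinv} }.

(* The atlas need not be maximal.  [chart_at p] is a chosen chart at [p]; it
   only serves to represent tangent vectors, see [tangent]. *)
Record manifold (R : realType) (n : nat) := Manifold {
  carrier :> topologicalType;
  carrier_hausdorff : hausdorff_space carrier;
  carrier_second_countable : @second_countable carrier;
  atlas : set (chart R n carrier);
  chart_at : carrier -> chart R n carrier;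
  chart_at_atlas : forall p, atlas (chart_at p);
  chart_at_dom : forall p, cdom (chart_at p) p;
  atlas_smooth : forall a b, atlas a -> atlas b ->
    smooth_on (cmap a @` (cdom a `&` cdom b)) (cmap b \o cinv a) }.

(* T_p N is identified with R^n through the differential at p of [chart_at p]:
   a tangent vector is the row of its components in that chart. *)
Definition tangent (R : realType) (n : nat) (N : manifold R n) (p : N) : Type :=
  'rV[R]_n.

Definition vfield (R : realType) (n : nat) (N : manifold R n) : Type :=
  forall p : N, tangent p.

Section Calculus.
Variables (R : realType) (n : nat) (N : manifold R n).
Implicit Types (p : N) (a : chart R n N) (U : set N) (X Y : vfield N).

Definition pos p : 'rV[R]_n := cmap (chart_at p) p.

(* components in the chart [a] of a tangent vector at [p] *)
Definition coords a p (v : tangent p) : 'rV[R]_n :=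
  'd (cmap a \o cinv (chart_at p)) (pos p) v.

(* the coordinate vector field d/dx_i of the chart [a] *)
Definition coord_field a (i : 'I_n) : vfield N := fun p =>
  'd (cmap (chart_at p) \o cinv a) (cmap a p) (delta_mx 0 i).

Definition smooth_fun U (f : N -> R) : Prop :=
  forall a, atlas a -> smooth_on (cmap a @` (cdom a `&` U)) (f \o cinv a).

Definition smooth_vfield U X : Prop :=
  forall a, atlas a ->
    smooth_on (cmap a @` (cdom a `&` U)) (fun x => coords a (X (cinv a x))).

(* the derivative v(f) *)
Definition dfun (f : N -> R) p (v : tangent p) : R :=
  'd (f \o cinv (chart_at p)) (pos p) v.

(* local expression of [X] in the chosen chart of [p] *)
Definition local_expr p X (x : 'rV[R]_n) : 'rV[R]_n :=
  coords (chart_at p) (X (cinv (chart_at p) x)).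

(* [X, Y]^k = X(Y^k) - Y(X^k) *)
Definition bracket X Y : vfield N := fun p =>
  'd (local_expr p Y) (pos p) (X p) - 'd (local_expr p X) (pos p) (Y p).

Definition is_basis p (E : 'I_n -> tangent p) : Prop :=
  basis_of {: 'rV[R]_n} [tuple (E j : 'rV[R]_n) | j < n].

End Calculus.

(* [grad i p] is the fibre H^i_p, with the convention H^0 = 0.  The rank of a
   sub-bundle is allowed to vary here (it is constant in the equiregular case,
   where [grad_smooth] provides local frames).  [grad_step] contains the
   condition that the union of the H^i be TN.  *)
Record gradation (R : realType) (n : nat) (N : manifold R n) := Gradation {
  grad :> nat -> forall p : N, {vspace 'rV[R]_n};
  grad0 : forall p, grad 0 p = 0%VS;
  grad_smooth : forall i p (v : tangent p), v \in grad i p ->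
    exists U, exists X : vfield N,
      [/\ open_nbhs p U, smooth_vfield U X,
          (forall q, U q -> X q \in grad i q) & X p = v];
  grad_mono : forall i j p, (i <= j)%N -> (grad i p <= grad j p)%VS;
  grad_bracket : forall i j U (X Y : vfield N), (0 < i)%N -> (0 < j)%N ->
    open U -> smooth_vfield U X -> smooth_vfield U Y ->
    (forall q, U q -> X q \in grad i q) ->
    (forall q, U q -> Y q \in grad j q) ->
    forall q, U q -> bracket X Y q \in grad (i + j)%N q;
  grad_step : forall p, exists s, grad s p = fullv }.

Section Graded.
Variables (R : realType) (n : nat) (N : manifold R n) (H : gradation N).

Definition equiregular : Prop :=
  forall i (p q : N), \dim (H i p) = \dim (H i q).

(* Frames are indexed from 0: X_1, ..., X_(n_i) are the [X j] with j < n_i. *)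
Definition adapted_frame (U : set N) (X : 'I_n -> vfield N) : Prop :=
  [/\ forall j, smooth_vfield U (X j),
      forall q, U q -> is_basis (fun j => X j q)
    & forall q, U q -> forall i,
        H i q = (\sum_(j < n | (j < \dim (H i q))%N) <[X j q : 'rV[R]_n]>)%VS].

Lemma grad_dim_gt (p : N) (j : 'I_n) : exists i, (j < \dim (H i p))%N.
Proof.
have [s Hs] := grad_step H p; exists s.
by rewrite Hs dimvf /dim /= mul1n.
Qed.

(* the i such that n_(i-1) < j <= n_i (1-based j) *)
Definition deg (p : N) (j : 'I_n) : nat := ex_minn (grad_dim_gt p j).

End Graded.

Definition strictly_increasing (m n : nat) (J : {ffun 'I_m -> 'I_n}) : bool :=
  [forall a : 'I_m, forall b : 'I_m, (a < b)%N ==> (J a < J b)%N].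

Definition multi_index (m n : nat) : Type :=
  {J : {ffun 'I_m -> 'I_n} | strictly_increasing J}.
HB.instance Definition _ m n := Finite.on (multi_index m n).

(* Lambda^m(R^n), by components in the basis (e_J) indexed by J *)
Definition mvector (R : realType) (m n : nat) : Type :=
  {ffun multi_index m n -> R^o}.
HB.instance Definition _ (R : realType) m n :=
  GRing.Lmodule.on (mvector R m n).

(* the components of v_1 /\ ... /\ v_m are the m x m minors *)
Definition wedge (R : realType) (m n : nat) (v : 'I_m -> 'rV[R]_n) :
    mvector R m n :=
  [ffun J : multi_index m n => \det (\matrix_(a, b) v a 0 (val J b))].

(* v_1 /\ ... /\ w /\ ... /\ v_m, with w in position k *)
Definition wedge_at (R : realType) (m n : nat) (v : 'I_m -> 'rV[R]_n)
    (k : 'I_m) (w : 'rV[R]_n) : mvector R m n :=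
  wedge (fun a => if a == k then w else v a).

(* [gram p] is the Gram matrix of the metric in the chosen chart at [p]. *)
Record metric (R : realType) (n : nat) (N : manifold R n) := Metric {
  gram : N -> 'M[R]_n;
  inner : forall p : N, tangent p -> tangent p -> R :=
    fun p u v => ((u : 'rV[R]_n) *m gram p *m (v : 'rV[R]_n)^T) 0 0;
  gram_sym : forall p, (gram p)^T = gram p;
  gram_pos : forall p (v : tangent p), v != 0 -> 0 < inner v v;
  gram_smooth : forall a, atlas a -> forall i j,
    smooth_on (cmap a @` cdom a)
      (fun x => inner (coord_field a i (cinv a x))
                      (coord_field a j (cinv a x))) }.

Section Connection.
Variables (R : realType) (n : nat) (N : manifold R n).

(* the bilinear extension to m-vectors of det <v_i, w_j>, expanded on (e_J) *)
Definition inner_mvec (g : metric N) (m : nat) (p : N)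
    (xi eta : mvector R m n) : R :=
  \sum_(I : multi_index m n) \sum_(J : multi_index m n)
    xi I * eta J *
    \det (\matrix_(a, b) inner g (p := p) (delta_mx 0 (val I a))
                                          (delta_mx 0 (val J b))).

(* [nabla p v X] is the covariant derivative of X at p in the direction v; its
   value is meaningful when X is smooth near p. *)
Definition connection_op : Type :=
  forall p : N, tangent p -> vfield N -> tangent p.

Record is_connection (nabla : connection_op) : Prop := IsConnection {
  nabla_linear : forall p c (u v : tangent p) X,
    nabla p (c *: (u : 'rV[R]_n) + v) X =
    c *: (nabla p u X : 'rV[R]_n) + nabla p v X;
  nabla_add : forall p U (v : tangent p) X Y, open_nbhs p U ->
    smooth_vfield U X -> smooth_vfield U Y ->
    nabla p v (fun q => (X q : 'rV[R]_n) + Y q) =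
    (nabla p v X : 'rV[R]_n) + nabla p v Y;
  nabla_leibniz : forall p U (v : tangent p) (f : N -> R) X, open_nbhs p U ->
    smooth_fun U f -> smooth_vfield U X ->
    nabla p v (fun q => f q *: (X q : 'rV[R]_n)) =
    dfun f v *: (X p : 'rV[R]_n) + f p *: (nabla p v X : 'rV[R]_n);
  nabla_smooth : forall U X Y, open U ->
    smooth_vfield U X -> smooth_vfield U Y ->
    smooth_vfield U (fun q => nabla q (X q) Y) }.

Record levi_civita (g : metric N) (nabla : connection_op) : Prop := LeviCivita {
  lc_connection : is_connection nabla;
  lc_torsion_free : forall p U X Y, open_nbhs p U ->
    smooth_vfield U X -> smooth_vfield U Y ->
    (nabla p (X p) Y : 'rV[R]_n) - nabla p (Y p) X = bracket X Y p;
  lc_metric : forall p U (v : tangent p) X Y, open_nbhs p U ->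
    smooth_vfield U X -> smooth_vfield U Y ->
    dfun (fun q => inner g (X q) (Y q)) v =
    inner g (nabla p v X) (Y p) + inner g (X p) (nabla p v Y) }.

(* Leibniz rule for nabla_v (X_1 /\ ... /\ X_m) *)
Definition nabla_wedge (nabla : connection_op) (m : nat) (p : N)
    (v : tangent p) (X : 'I_m -> vfield N) : mvector R m n :=
  \sum_(k < m) wedge_at (fun a => X a p) k (nabla p v (X k)).

End Connection.

Section Immersion.
Variables (R : realType) (m n : nat) (M : manifold R m) (N : manifold R n).
Variable Phi : M -> N.

Definition smooth_map : Prop :=
  continuous Phi /\
  forall a b, atlas a -> atlas b ->
    smooth_on (cmap a @` (cdom a `&` Phi @^-1` cdom b))
              (cmap b \o Phi \o cinv a).

Definition dmap (p : M) (v : tangent p) : tangent (Phi p) :=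
  'd (cmap (chart_at (Phi p)) \o Phi \o cinv (chart_at p)) (pos p) v.

Definition immersion : Prop :=
  smooth_map /\ forall p : M, injective (@dmap p).

Definition field_along : Type := forall p : M, tangent (Phi p).

(* the space X_0(M, N) *)
Definition compact_smooth_along (V : field_along) : Prop :=
  (forall a b, atlas a -> atlas b ->
     smooth_on (cmap a @` (cdom a `&` Phi @^-1` cdom b))
               (fun x => coords b (V (cinv a x)))) /\
  compact (closure [set p | V p <> (0 : 'rV[R]_n)]).

(* The induced covariant derivative, by the Leibniz rule on V = V^i d/dx_i in
   the chosen chart at Phi p, where the i-th coordinate vector at Phi p is the
   i-th unit row:  nabla_w V = w(V^i) d/dx_i + V^i nabla_(dPhi w) d/dx_i. *)
Definition nabla_along (nabla : connection_op N) (V : field_along) (p : M)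
    (w : tangent p) : tangent (Phi p) :=
  let c := chart_at (Phi p) in
  'd (fun x => coords c (V (cinv (chart_at p) x))) (pos p) w +
  \sum_(i < n) (V p : 'rV[R]_n) 0 i *:
               (nabla (Phi p) (dmap w) (coord_field c i) : 'rV[R]_n).

Variable H : gradation N.

Definition deg_multi (p : N) (J : multi_index m n) : nat :=
  \sum_(a < m) deg H p (val J a).

Definition mvec_degree (p : N) (xi : mvector R m n) (d : nat) : Prop :=
  exists U, exists X : 'I_n -> vfield N, exists lambda : multi_index m n -> R,
    [/\ open_nbhs p U, adapted_frame H U X,
        xi = \sum_J lambda J *: wedge (fun a => X (val J a) p)
      & d = \max_(J | lambda J != 0) deg_multi p J].

Definition point_degree (p : M) (d : nat) : Prop :=
  exists E : 'I_m -> tangent p,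
    is_basis E /\ mvec_degree (Phi p) (wedge (fun k => dmap (E k))) d.

Definition immersion_degree (d : nat) : Prop :=
  (forall p, exists2 k, point_degree p k & (k <= d)%N) /\
  (exists p, point_degree p d).

Definition orthonormal_frame (g : metric N) (U : set N)
    (X : 'I_n -> vfield N) : Prop :=
  forall q, U q -> forall i j, inner g (X i q) (X j q) = (i == j)%:R.

(* [nabla] stands for the Levi-Civita connection of [g]. *)
Definition admissible (d : nat) (g : metric N) (nabla : connection_op N)
    (V : field_along) : Prop :=
  forall p : M,
  exists U, exists X : 'I_n -> vfield N, exists E : 'I_m -> tangent p,
    let e := fun k => dmap (E k) in
    [/\ open_nbhs (Phi p) U, adapted_frame H U X, orthonormal_frame g U X,
        is_basis E
      & forall J : multi_index m n, (d < deg_multi (Phi p) J)%N ->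
        let XJ := fun a => X (val J a) in
        0 = inner_mvec g (Phi p) (wedge e) (nabla_wedge nabla (V p) XJ) +
            \sum_(k < m)
              inner_mvec g (Phi p)
                (wedge_at e k (nabla_along nabla V (E k)))
                (wedge (fun a => XJ a (Phi p)))].

End Immersion.

(* Main.v *)
(** Fix a point p = Phi(pbar) and a basis e_k of the tangent space of the image.
    In an adapted g-orthonormal frame X, put A_kj = <e_k, X_j> and
    W_kj = <nabla_{e_k} V, X_j> + <e_k, nabla_V X_j>.  By the Cauchy-Binet
    formula the admissibility equation of index J says that the derivative of
    the J-minor of A in the direction W vanishes.  Metric compatibility makes
    the rows of W the components of
    w_k = nabla_{e_k} V - sum_i A_ki nabla_V X_i, and the Christoffel symbols of
    a torsion-free connection cancel in w_k, which therefore depends on the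
    frame only.  Let Y be the adapted g'-orthonormal frame obtained from X by
    Gram-Schmidt, X_j = sum_i Q_ji Y_i and T = V(Q); both Q and T are block
    triangular with respect to the degree.  Then (A, W) is replaced by
    (A Q, W Q + A T), and since the minors of A of degree > d vanish, expanding
    minors shows that the equations of degree > d for (A, W) imply those for
    (A Q, W Q + A T). *)

From HB Require Import structures.
Require Import Defs.
From mathcomp Require Import all_boot all_order all_fingroup all_algebra.
From mathcomp Require Import all_classical all_reals all_analysis.

Set Implicit Arguments.
Unset Strict Implicit.
Unset Printing Implicit Defensive.
Import Order.TTheory GRing.Theory Num.Theory.
Local Open Scope ring_scope.

(** * Minors *)

Section CauchyBinet.
Variable R : comNzRingType.

(** Each column of [A *m C] is a combination of columns of [A]; multilinearity gives a sum over all
    maps [h] choosing one column each. Keeping every [h], increasing or not, lets the degree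
    arguments below kill terms through a single factor of the product. *)
Lemma det_mulmx_expand m n (A : 'M[R]_(m, n)) (C : 'M[R]_(n, m)) :
  \det (A *m C) =
  \sum_(h : {ffun 'I_m -> 'I_n}) (\prod_b C (h b) b) * \det (colsub h A).
Proof.
pose AC (s : 'S_m) b i := A (s b) i * C i b.
transitivity (\sum_(s : 'S_m) \sum_(h : {ffun 'I_m -> 'I_n})
    (-1) ^+ s * \prod_b AC s b (h b)).
  rewrite -det_tr; apply: eq_bigr => s _; rewrite -big_distrr /=.
  congr (_ * _); rewrite -(bigA_distr_bigA (AC s)) /=.
  by apply: eq_bigr => b _; rewrite !mxE.
rewrite exchange_big; apply: eq_bigr => h _ /=.
rewrite -det_tr big_distrr; apply: eq_bigr => s _ /=.
rewrite mulrCA big_split /=; congr (_ * _); rewrite mulrC; congr (_ * _).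
by apply: eq_bigr => b _; rewrite !mxE.
Qed.

Lemma det_colsub_perm m n (A : 'M[R]_(m, n)) (f : 'I_m -> 'I_n) (s : 'S_m) :
  \det (colsub (f \o s) A) = (-1) ^+ s * \det (colsub f A).
Proof.
have -> : colsub (f \o s) A = col_perm s (colsub f A).
  by apply/matrixP => i j; rewrite !mxE.
by rewrite col_permE det_mulmx det_perm odd_permV mulrC.
Qed.

Lemma det_colsub_noninj m n (A : 'M[R]_(m, n)) (f : {ffun 'I_m -> 'I_n}) :
  ~~ injectiveb f -> \det (colsub f A) = 0.
Proof.
case/injectivePn => i1 [i2 Di12 Ef12]; rewrite -det_tr.
by rewrite (determinant_alternate Di12) // => j; rewrite !mxE Ef12.
Qed.

Lemma multi_index_lt m n (J : multi_index m n) (a b : 'I_m) :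
  (a < b)%N -> (val J a < val J b)%N.
Proof. by have /forallP/(_ a)/forallP/(_ b)/implyP := valP J. Qed.

Lemma multi_index_inj m n (J : multi_index m n) : injective (val J).
Proof.
move=> a b eq_ab; apply/val_inj; case: (ltngtP a b) => // /(multi_index_lt J).
  by rewrite eq_ab ltnn.
by rewrite eq_ab ltnn.
Qed.

(** The sorted image of [h] is [J], and [s a] is the rank of [h a] in it. *)
Lemma injective_sort m n (h : {ffun 'I_m -> 'I_n}) : injectiveb h ->
  exists J : multi_index m n, exists s : 'S_m, h =1 val J \o s.
Proof.
move=> /injectiveP h_inj.
pose r := sort (relpre val leq) (codom h).
have szr : size r = m by rewrite size_sort size_codom card_ord.
have r_uniq : uniq r by rewrite sort_uniq; apply/injectiveP.
have r_sorted : sorted (relpre val ltn) r.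
  rewrite -sorted_map ltn_sorted_uniq_leq map_inj_uniq ?r_uniq //=.
    by rewrite sorted_map sort_sorted // => x y; exact: leq_total.
  exact: val_inj.
(* For [m] = 0 there is no value of [h] to serve as the default [x0] of [nth]. *)
case: m => [|m] in h h_inj r szr r_uniq r_sorted *.
  have inc : strictly_increasing h by apply/forallP => -[].
  by exists (exist _ h inc), 1%g => -[].
pose x0 := h ord0.
pose J0 : {ffun 'I_m.+1 -> 'I_n} := [ffun b : 'I_m.+1 => nth x0 r b].
have inc : strictly_increasing J0.
  apply/forallP => a; apply/forallP => b; apply/implyP => ltab.
  rewrite !ffunE; apply: (sorted_ltn_nth _ _ r_sorted) => //;
    rewrite ?inE ?szr //; by move=> x y z; exact: ltn_trans.
have hr a : h a \in r by rewrite mem_sort codom_f.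
have idx a : (index (h a) r < m.+1)%N by rewrite -[X in (_ < X)%N]szr index_mem.
pose s0 a : 'I_m.+1 := Ordinal (idx a).
have s0_inj : injective s0.
  move=> a b /(congr1 val) /= eqi; apply: h_inj.
  by rewrite -(nth_index x0 (hr a)) eqi nth_index.
exists (exist _ J0 inc), (perm s0_inj) => a /=.
by rewrite permE ffunE /= nth_index.
Qed.

(** Sorting is unique: the permutation relating two increasing enumerations preserves the order,
    hence is the identity. *)
Lemma perm_multi_index_inj m n (J J' : multi_index m n) (s s' : 'S_m) :
  val J \o s =1 val J' \o s' -> J = J' /\ s = s'.
Proof.
move=> eq_s.
(* Such a [u] is increasing, so by induction it moves no index down. Applied to [t] and to its
   inverse, this gives [t a = a]. *)
have le_sort (K K' : multi_index m n) (u : 'I_m -> 'I_m) : injective u ->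
    (forall a, val K a = val K' (u a)) -> forall k : nat,
    forall a : 'I_m, (a : nat) = k -> (a <= u a)%N.
  move=> u_inj eqK; elim=> [|k IH] a eq_a; first by rewrite eq_a.
  have ltk : (k < m)%N by rewrite -eq_a ltnW.
  rewrite eq_a; apply: leq_ltn_trans (IH (Ordinal ltk) erefl) _.
  rewrite ltnNge leq_eqVlt; apply/negP => /orP[/eqP/val_inj/u_inj|].
    by move/(congr1 val) => /= eqk; move: eq_a; rewrite eqk => /n_Sn.
  move/(multi_index_lt K'); rewrite -!eqK ltnNge => /negP; apply.
  by apply/ltnW/multi_index_lt; rewrite eq_a.
pose t : 'S_m := (s^-1 * s')%g.
have eqt a : val J a = val J' (t a).
  by have := eq_s (s^-1 a)%g; rewrite /= permKV => ->; rewrite permM.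
have t1 a : t a = a.
  apply/val_inj/eqP; rewrite eqn_leq; apply/andP; split; last first.
    exact: (le_sort _ _ _ (@perm_inj _ t) eqt _ a erefl).
  have := le_sort J' J (t^-1)%g (@perm_inj _ _) _ _ (t a) erefl.
  by rewrite permK; apply=> b; rewrite eqt permKV.
split; first by apply/val_inj/ffunP => a; rewrite eqt t1.
have : t = 1%g by apply/permP => a; rewrite t1 perm1.
by move=> e; rewrite -[s']mul1g -(mulgV s) -mulgA -/t e mulg1.
Qed.

(** Maps with a repeated value contribute nothing, and an injective map is in a unique way a
    multi-index after a permutation. For fixed [J] the signed sum over permutations is the minor of
    [C]. *)
Lemma cauchy_binet m n (A : 'M[R]_(m, n)) (C : 'M[R]_(n, m)) :
  \det (A *m C) =
  \sum_(J : multi_index m n)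
     \det (colsub (val J) A) * \det (rowsub (val J) C).
Proof.
rewrite det_mulmx_expand (bigID (fun h : {ffun _} => injectiveb h)) /=.
rewrite addrC big1 ?add0r => [|h /det_colsub_noninj->]; last by rewrite mulr0.
pose P (x : multi_index m n * 'S_m) : {ffun 'I_m -> 'I_n} :=
  [ffun b => val x.1 (x.2 b)].
have P_inj : injective P.
  move=> [J s] [J' s'] /ffunP eqP.
  have [b|-> -> //] := @perm_multi_index_inj m n J J' s s'.
  by have := eqP b; rewrite !ffunE.
have imP : [set P x | x in [set: multi_index m n * 'S_m]] =
    [set h : {ffun 'I_m -> 'I_n} | injectiveb h].
  apply/setP => h; rewrite inE; apply/imsetP/idP => [[[J s] _ ->]|].
    apply/injectiveP => a b; rewrite !ffunE /=.
    by move/multi_index_inj/perm_inj.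
  move/injective_sort => [J [s eqh]]; exists (J, s); rewrite ?inE //.
  by apply/ffunP => b; rewrite ffunE eqh.
transitivity (\sum_(h in [set h : {ffun 'I_m -> 'I_n} | injectiveb h])
   (\prod_b C (h b) b) * \det (colsub h A)).
  by apply: eq_bigl => h; rewrite inE.
rewrite -imP big_imset /=; last by move=> x y _ _ /P_inj.
under eq_bigl do rewrite inE.
rewrite -(pair_bigA _ (fun J s => (\prod_b C (P (J, s) b) b) *
   \det (colsub (P (J, s)) A))) /=.
apply: eq_bigr => J _.
rewrite -[\det (rowsub _ _)]det_tr mulr_sumr; apply: eq_bigr => s _.
have -> : colsub (P (J, s)) A = colsub (val J \o s) A.
  by apply: eq_mxsub => // b; rewrite ffunE.
rewrite det_colsub_perm mulrA mulrC; congr (_ * _).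
by rewrite mulrC; congr (_ * _); apply: eq_bigr => b _; rewrite !mxE ffunE.
Qed.

End CauchyBinet.

(** * Derivative of a minor, by rows and by columns *)

Section DetDerivative.
Variable R : comNzRingType.

Definition row_subst m n (A W : 'M[R]_(m, n)) (k : 'I_m) : 'M[R]_(m, n) :=
  \matrix_(a, j) if a == k then W a j else A a j.

(* The derivative at t = 0 of the minor of A + t W on the columns f. *)
Definition dminor m n (A W : 'M[R]_(m, n)) (f : 'I_m -> 'I_n) : R :=
  \sum_(k < m) \det (colsub f (row_subst A W k)).

Lemma det_row_subst m (A B : 'M[R]_m) (k : 'I_m) :
  \det (row_subst A B k) = \sum_j B k j * cofactor A k j.
Proof.
rewrite (expand_det_row _ k); apply: eq_bigr => j _; rewrite mxE eqxx.
congr (_ * (_ * \det _)); apply/matrixP => a b; rewrite !mxE.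
by rewrite eq_sym (negbTE (neq_lift _ _)).
Qed.

(** Both sides are the sum of the entries of [B] times the cofactors of [A], that is, the derivative
    of the determinant at [A] in the direction [B]. *)
Lemma sum_det_row_col m (A B : 'M[R]_m) :
  \sum_k \det (row_subst A B k) =
  \sum_k \det (\matrix_(a, b) if b == k then B a b else A a b).
Proof.
transitivity (\sum_k \sum_j B j k * cofactor A j k); last first.
  apply: eq_bigr => k _; rewrite -det_tr.
  have -> : (\matrix_(a, b) (if b == k then B a b else A a b))^T =
      row_subst A^T B^T k by apply/matrixP => a b; rewrite !mxE.
  rewrite det_row_subst; apply: eq_bigr => j _.
  by rewrite mxE cofactor_tr.
by rewrite [RHS]exchange_big; apply: eq_bigr => k _; rewrite det_row_subst.
Qed.

Lemma dminorE m n (A W : 'M[R]_(m, n)) (f : 'I_m -> 'I_n) :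
  dminor A W f = \sum_(k < m) \sum_j W k (f j) * cofactor (colsub f A) k j.
Proof.
apply: eq_bigr => k _.
have -> : colsub f (row_subst A W k) = row_subst (colsub f A) (colsub f W) k.
  by apply/matrixP => a b; rewrite !mxE.
by rewrite det_row_subst; apply: eq_bigr => j _; rewrite !mxE.
Qed.

Lemma dminorD m n (A W W' : 'M[R]_(m, n)) (f : 'I_m -> 'I_n) :
  dminor A (W + W') f = dminor A W f + dminor A W' f.
Proof.
rewrite !dminorE -big_split; apply: eq_bigr => k _ /=.
by rewrite -big_split; apply: eq_bigr => j _ /=; rewrite mxE mulrDl.
Qed.

(** The form that suits [nabla_wedge], where one frame vector, hence one column, is altered at a
    time. *)
Lemma dminor_col m n (A W : 'M[R]_(m, n)) (f : 'I_m -> 'I_n) :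
  dminor A W f =
  \sum_k \det (\matrix_(a, b) if b == k then W a (f b) else A a (f b)).
Proof.
have -> : dminor A W f =
    \sum_k \det (row_subst (colsub f A) (colsub f W) k).
  apply: eq_bigr => k _; congr (\det _).
  by apply/matrixP => a b; rewrite !mxE.
rewrite sum_det_row_col; apply: eq_bigr => k _; congr (\det _).
by apply/matrixP => a b; rewrite !mxE.
Qed.

End DetDerivative.

(** * Minors of high degree under block triangular changes of columns *)

Section Filtration.
Variables (R : comNzRingType) (m n : nat) (dg : 'I_n -> nat) (d : nat).
Implicit Types (A W : 'M[R]_(m, n)) (Q T : 'M[R]_n).

Definition high (f : 'I_m -> 'I_n) : bool := (d < \sum_(b < m) dg (f b))%N.

(** Row [j] is meant to hold the components of the [j]-th field of one adapted frame in another; the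
    condition says that the flag is respected. *)
Definition block_triangular Q := forall j i, (dg j < dg i)%N -> Q j i = 0.

Lemma high_perm (f : 'I_m -> 'I_n) (s : 'S_m) : high (f \o s) = high f.
Proof. by rewrite /high [in RHS](reindex_perm s). Qed.

(** Admissibility speaks of increasing indices only, whereas [det_mulmx_expand] ranges over all
    maps. Permuting columns changes a sign and not the degree. *)
Lemma minor_high A :
  (forall J : multi_index m n, high (val J) -> \det (colsub (val J) A) = 0) ->
  forall f : {ffun 'I_m -> 'I_n}, high f -> \det (colsub f A) = 0.
Proof.
move=> A0 f hf; have [/injective_sort[J [s eqf]]|] := boolP (injectiveb f).
  have -> : colsub f A = colsub (val J \o s) A.
    by apply/matrixP => a b; rewrite !mxE eqf.
  rewrite det_colsub_perm A0 ?mulr0 //.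
  by rewrite -(high_perm _ s) /high; under eq_bigr do rewrite -eqf.
exact: det_colsub_noninj.
Qed.

Lemma dminor_high A W :
  (forall J : multi_index m n, high (val J) -> dminor A W (val J) = 0) ->
  forall f : {ffun 'I_m -> 'I_n}, high f -> dminor A W f = 0.
Proof.
move=> A0 f hf; have [/injective_sort[J [s eqf]]|nf] := boolP (injectiveb f).
  transitivity ((-1) ^+ s * dminor A W (val J)).
    rewrite mulr_sumr; apply: eq_bigr => k _; rewrite -det_colsub_perm.
    by congr (\det _); apply/matrixP => a b; rewrite !mxE eqf.
  rewrite A0 ?mulr0 //.
  by rewrite -(high_perm _ s) /high; under eq_bigr do rewrite -eqf.
by rewrite /dminor big1 // => k _; rewrite det_colsub_noninj.
Qed.

(** If [dg (h b)] were at least [dg (f b)] for every [b], then [h] would be high like [f]; so some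
    factor has a row of lower degree and vanishes. *)
Lemma prod_high0 (C : 'M[R]_(n, m)) (f : 'I_m -> 'I_n)
    (h : {ffun 'I_m -> 'I_n}) :
  (forall j b, (dg j < dg (f b))%N -> C j b = 0) -> high f -> ~~ high h ->
  \prod_b C (h b) b = 0.
Proof.
move=> C0 hf hh.
have [/existsP[b ltb]|] := boolP [exists b, dg (h b) < dg (f b)]%N.
  by rewrite (bigD1 b) //= C0 // mul0r.
rewrite negb_exists => /forallP ge_h; case/negP: hh.
apply: leq_trans hf _; apply: leq_sum => b _.
by rewrite leqNgt ge_h.
Qed.

(** In the expansion a high [h] kills the minor of [A], any other [h] kills the product. The
    condition on [C] is columnwise, so that columns of two different block triangular matrices can
    be mixed. *)
Lemma det_mulmx_high A (C : 'M[R]_(n, m)) (f : 'I_m -> 'I_n) :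
  (forall h : {ffun 'I_m -> 'I_n}, high h -> \det (colsub h A) = 0) ->
  (forall j b, (dg j < dg (f b))%N -> C j b = 0) -> high f ->
  \det (A *m C) = 0.
Proof.
move=> A0 C0 hf; rewrite det_mulmx_expand big1 // => h _.
have [/A0->|hh] := boolP (high h); first by rewrite mulr0.
by rewrite (prod_high0 C0) ?mul0r.
Qed.

Lemma dminor_change A W Q T :
  block_triangular Q -> block_triangular T ->
  (forall J : multi_index m n, high (val J) -> \det (colsub (val J) A) = 0) ->
  (forall J : multi_index m n, high (val J) -> dminor A W (val J) = 0) ->
  forall f : 'I_m -> 'I_n, high f ->
  dminor (A *m Q) (W *m Q + A *m T) f = 0.
Proof.
move=> Q0 T0 /minor_high A0 /dminor_high W0 f hf; rewrite dminorD.
(* The part in the direction [A *m T], taken by columns: each term is the determinant of [A *m C],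
   where [C] has its column [k] from [T] and the others from [Q]. *)
rewrite [X in _ + X](_ : _ = 0) ?addr0; last first.
  rewrite dminor_col big1 // => k _.
  pose C := \matrix_(i, b) if b == k then T i (f b) else Q i (f b).
  rewrite (_ : (\matrix_(a, b) _) = A *m C).
    apply: det_mulmx_high hf => // j b lt_jb; rewrite mxE.
    by case: eqP => _; [exact: T0 | exact: Q0].
  apply/matrixP => a b; rewrite !mxE.
  by case: eqP => [->|/eqP/negbTE nb]; apply: eq_bigr => i _;
     rewrite mxE ?eqxx ?nb.
(* Replacing a row commutes with right multiplication by [Q]. In the expansion the coefficient of
   [h] does not depend on [k], so the sum over [k] rebuilds [dminor A W h]. *)
transitivity (\sum_k \sum_(h : {ffun 'I_m -> 'I_n})
    (\prod_b Q (h b) (f b)) * \det (colsub h (row_subst A W k))).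
  apply: eq_bigr => k _.
  rewrite (_ : row_subst _ _ _ = row_subst A W k *m Q).
    rewrite -mulmx_colsub det_mulmx_expand; apply: eq_bigr => h _.
    by congr (_ * _); apply: eq_bigr => b _; rewrite mxE.
  apply/matrixP => a b; rewrite !mxE.
  by case: eqP => [->|/eqP/negbTE nb]; apply: eq_bigr => i _;
     rewrite mxE ?eqxx ?nb.
rewrite exchange_big /= big1 // => h _; rewrite -mulr_sumr.
rewrite -/(dminor A W h).
have [/W0->|hh] := boolP (high h); first by rewrite mulr0.
pose C := \matrix_(i, b) Q i (f b).
have C0 : forall j b, (dg j < dg (f b))%N -> C j b = 0.
  by move=> j b lt_jb; rewrite mxE Q0.
have := prod_high0 C0 hf hh; under eq_bigr do rewrite mxE.
by move->; rewrite mul0r.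
Qed.

End Filtration.

Local Open Scope classical_set_scope.

(** * Differentiable functions of class C^k *)

Section Differential.
Variable R : realType.

(** Local expressions in charts are identified only near a point. The first order expansion of [f]
    is then one of [g], and the differential is unique. *)
Lemma near_eq_is_diff (V W : normedModType R) (f g : V -> W) (x : V) :
  (\near x, f x = g x) -> differentiable f x ->
  differentiable g x /\ 'd g x = 'd f x :> (V -> W).
Proof.
move=> fg df; have [dfc dfo] := (diff_locallyP x f).1 df.
have go : g \o shift x = cst (g x) + 'd f x +o_ 0 id.
  apply/eqaddoP => e e0; have := (eqaddoP _ _ _ _).1 dfo e e0.
  have fg0 : \forall h \near 0, f (h + x) = g (h + x).
    have := fg; rewrite (near_shift 0) /= => fg'.
    by apply: filterS fg' => h /=; rewrite subr0.
  apply: filterS2 fg0 => h /= eqh.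
  by rewrite -[_ h]/(f (h + x) - (f x + _)) eqh (nbhs_singleton fg).
have dgE : 'd g x = 'd f x :> (V -> W) by apply: diff_unique.
split; last exact: dgE.
by apply/diff_locallyP; rewrite dgE; split; [exact: dfc | exact: go].
Qed.

Lemma near_eq_diff_comp (U V W : normedModType R) (h : U -> V) (f : V -> W)
    (F : U -> W) (x : U) (y : V) :
  h x = y -> differentiable h x -> differentiable f y ->
  (\forall z \near x, f (h z) = F z) ->
  forall v, 'd F x v = 'd f y ('d h x v).
Proof.
move=> <- dh df eqF v.
have dfh : differentiable (f \o h) x by exact: differentiable_comp.
by have [_ ->] := near_eq_is_diff eqF dfh; rewrite diff_comp.
Qed.

Lemma near_eq_diff_id (V : normedModType R) (f : V -> V) (x : V) :
  (\forall y \near x, y = f y) -> forall v, 'd f x v = v.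
Proof.
move=> eqf v; have di : differentiable (@idfun V) x by [].
have [_ ->] := near_eq_is_diff (f := idfun) eqf di.
by have [_ ->] := is_diff_id x.
Qed.

Lemma near_eq_diff_cst (V W : normedModType R) (f : V -> W) (c : W) (x : V) :
  (\forall y \near x, c = f y) -> forall v, 'd f x v = 0.
Proof.
move=> eqf v; have dc := differentiable_cst c x.
have [_ ->] := near_eq_is_diff (f := cst c) eqf dc.
by rewrite diff_cst.
Qed.

Lemma is_linear_coord n (i : 'I_n) :
  linear (fun v : 'rV[R]_n => v 0 i : R).
Proof. by move=> a u v; rewrite !mxE. Qed.

Lemma diff_coord (V : normedModType R) n (f : V -> 'rV[R]_n) (x v : V) i :
  differentiable f x ->
  differentiable (fun y => f y 0 i : R) x /\
  'd (fun y => f y 0 i : R) x v = 'd f x v 0 i.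
Proof.
move=> df; pose cM := GRing.isLinear.Build _ _ _ _ _ (is_linear_coord i).
pose c : {linear 'rV[R]_n -> R} := HB.pack (fun v : 'rV[R]_n => v 0 i : R) cM.
have cc : continuous c by exact: coord_continuous.
have dc := linear_differentiable (f x) cc.
split; first exact: (@differentiable_comp _ _ _ _ f c).
by rewrite (@diff_comp _ _ _ _ f c) // -[LHS]/('d c (f x) ('d f x v)) diff_lin.
Qed.

Lemma differentiable_row (V : normedModType R) n (f : V -> 'rV[R]_n) (x : V) :
  (forall i, differentiable (fun y => f y 0 i : R) x) -> differentiable f x.
Proof.
move=> df.
have -> : f = \sum_(i < n) (fun y => (f y 0 i : R) *: delta_mx 0 i).
  by apply/funext => y; rewrite fct_sumE -row_sum_delta.
by apply: differentiable_sum => i; exact: differentiableZl.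
Qed.

Lemma diff_row_comp (V : normedModType R) n (W : normedModType R)
    (h : V -> 'rV[R]_n) (f : 'rV[R]_n -> W) (x v : V) :
  differentiable h x -> differentiable f (h x) ->
  'd (f \o h) x v = \sum_i ('d h x v 0 i) *: 'd f (h x) (delta_mx 0 i).
Proof.
move=> dh df; rewrite diff_comp //= {1}(row_sum_delta ('d h x v)) linear_sum.
by apply: eq_bigr => i _; rewrite linearZ.
Qed.

End Differential.

(** * Stability of the class C^k under algebraic operations and composition *)

Section Ck.
Variables (R : realType) (n : nat).
Implicit Types (W : normedModType R) (A B : set 'rV[R]_n) (k : nat).

Lemma open_near A x (P : 'rV[R]_n -> Prop) : open A -> A x ->
  (forall y, A y -> P y) -> \near x, P x.
Proof.
by move=> oA Ax AP; apply: filterS AP (open_nbhs_nbhs _); split.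
Qed.

Lemma Ck_on_eq W k A (f g : 'rV[R]_n -> W) : open A ->
  (forall x, A x -> f x = g x) -> Ck_on k A f -> Ck_on k A g.
Proof.
move=> oA; elim: k f g => [|k IH] f g fg /=.
  move=> cf x Ax; have nfg : \near x, f x = g x by exact: open_near fg.
  rewrite /prop_for /continuous_at -(fg _ Ax).
  exact: cvg_trans (@near_eq_cvg _ _ (nbhs x) _ f g nfg) (cf x Ax).
move=> [df Df]; split=> [x Ax|v].
  by have [] := near_eq_is_diff (open_near oA Ax fg) (df x Ax).
apply: IH (Df v) => x Ax; apply: near_eq_derive; exact: open_near fg.
Qed.

Lemma Ck_on_sub W k A B (f : 'rV[R]_n -> W) : B `<=` A ->
  Ck_on k A f -> Ck_on k B f.
Proof.
move=> BA; elim: k f => [|k IH] f /=; first by move=> cf x /BA/cf.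
by move=> [df Df]; split=> [x /BA/df //|v]; exact: IH.
Qed.

Lemma Ck_onW W k A (f : 'rV[R]_n -> W) : Ck_on k.+1 A f -> Ck_on k A f.
Proof.
elim: k f => [|k IH] f; last by move=> [df Df]; split=> // v; exact/IH/Df.
by move=> [df _] x /df/differentiable_continuous.
Qed.

Lemma Ck_on_cst W k A (c : W) : Ck_on k A (fun=> c).
Proof.
elim: k c => [|k IH] c /=; first by move=> x _; exact: cst_continuous.
split=> [x _|v]; first exact: differentiable_cst.
have -> : 'D_v (fun=> c) = fun _ : 'rV[R]_n => 0 :> W.
  by apply/funext => x; exact: derive_cst.
exact: IH.
Qed.

Lemma Ck_onD W k A (f g : 'rV[R]_n -> W) : open A ->
  Ck_on k A f -> Ck_on k A g -> Ck_on k A (fun x => f x + g x).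
Proof.
move=> oA; elim: k f g => [|k IH] f g.
  by move=> cf cg x Ax; exact: continuousD (cf x Ax) (cg x Ax).
move=> [df Df] [dg Dg]; split=> [x Ax|v].
  exact: differentiableD (df x Ax) (dg x Ax).
apply: Ck_on_eq (IH _ _ (Df v) (Dg v)) => // x Ax.
rewrite -[fun x => f x + g x]/(f + g) deriveD //.
  exact/diff_derivable/df.
exact/diff_derivable/dg.
Qed.

Lemma Ck_on_sum W k A (I : Type) (r : seq I) (P : pred I)
    (f : I -> 'rV[R]_n -> W) : open A ->
  (forall i, P i -> Ck_on k A (f i)) ->
  Ck_on k A (fun x => \sum_(i <- r | P i) f i x).
Proof.
move=> oA Cf; elim: r => [|i r IH].
  by under eq_fun do rewrite big_nil; exact: Ck_on_cst.
under eq_fun do rewrite big_cons.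
by have [/Cf Ci|//] := boolP (P i); exact: Ck_onD.
Qed.

Lemma Ck_on_coord k A m (f : 'rV[R]_n -> 'rV[R]_m) : open A ->
  Ck_on k A f <-> forall i, Ck_on k A (fun x => f x 0 i : R).
Proof.
move=> oA; elim: k f => [|k IH] f.
  split=> [cf i x Ax|cf x Ax].
    apply: (@continuous_comp _ _ _ f (fun v : 'rV[R]_m => v 0 i : R)).
      exact: cf.
    exact: coord_continuous.
  have -> : f = fun y => \sum_(i < m) (f y 0 i : R) *: delta_mx 0 i.
    by apply/funext => y; rewrite -row_sum_delta.
  apply: (@Ck_on_sum _ 0 A) Ax => // i _ y Ay.
  have cfi : {for y, continuous (fun z => f z 0 i : R)} by exact: cf.
  apply: (@continuous_comp _ _ _ (fun z => f z 0 i)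
    (fun c : R => c *: (delta_mx 0 i : 'rV[R]_m))).
    exact: cfi.
  exact: scalel_continuous.
have DfE i v x : differentiable f x ->
    'D_v (fun x => f x 0 i : R) x = 'D_v f x 0 i.
  by move=> df; have [di e] := diff_coord v i df; rewrite !deriveE.
split=> [[df Df] i|Cf].
  split=> [x Ax|v]; first by have [] := diff_coord 0 i (df x Ax).
  apply: (@Ck_on_eq _ k A (fun x => 'D_v f x 0 i)) => // [x Ax|].
    by rewrite DfE //; exact: df.
  by have /IH := Df v; exact.
have df x : A x -> differentiable f x.
  by move=> Ax; apply: differentiable_row => i; have [+ _] := Cf i; exact.
split=> // v; apply/IH => i; have [_ /(_ v)] := Cf i.
by apply: Ck_on_eq => // x Ax; rewrite DfE //; exact: df.
Qed.

Lemma Ck_onM k A (f g : 'rV[R]_n -> R) : open A ->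
  Ck_on k A f -> Ck_on k A g -> Ck_on k A (fun x => f x * g x).
Proof.
move=> oA; elim: k f g => [|k IH] f g.
  by move=> cf cg x Ax; exact: continuousM (cf x Ax) (cg x Ax).
move=> Cf Cg; have [df Df] := Cf; have [dg Dg] := Cg; split=> [x Ax|v].
  exact: differentiableM (df x Ax) (dg x Ax).
have := Ck_onD oA (IH _ _ (Ck_onW Cf) (Dg v)) (IH _ _ (Ck_onW Cg) (Df v)).
apply: Ck_on_eq => // x Ax.
rewrite -[fun x => f x * g x]/(f * g) deriveM //.
  exact/diff_derivable/df.
exact/diff_derivable/dg.
Qed.

(** Differentiating lowers the exponent by one, so the induction on [k] is over all exponents. The
    case needed is -1/2, for normalizing vectors. *)
Lemma Ck_on_powR k A (f : 'rV[R]_n -> R) (a : R) : open A ->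
  (forall x, A x -> 0 < f x) -> Ck_on k A f -> Ck_on k A (fun x => f x `^ a).
Proof.
move=> oA f0; have dp b x : A x -> differentiable (fun y : R => y `^ b) (f x).
  by move=> /f0 fx0; apply/derivable1_diffP; have [] := is_derive1_powR b fx0.
elim: k f0 dp a => [|k IH] f0 dp a.
  move=> cf x Ax; apply: (@continuous_comp _ _ _ f (fun y : R => y `^ a)).
    exact: cf.
  exact/differentiable_continuous/dp.
move=> Cf; have [df Df] := Cf; split=> [x Ax|v].
  by apply: (@differentiable_comp _ _ _ _ f (fun y : R => y `^ a));
    [exact: df|exact: dp].
have C1 := IH f0 dp (a - 1) (Ck_onW Cf).
have := Ck_onM oA (Ck_onM oA (Ck_on_cst k A a) C1) (Df v).
apply: Ck_on_eq => // x Ax.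
rewrite !deriveE //; last exact: df; last first.
  by apply: (@differentiable_comp _ _ _ _ f (fun y : R => y `^ a));
    [exact: df|exact: dp].
rewrite (@diff_comp _ _ _ _ f (fun y : R => y `^ a)) //=; last exact: dp.
  rewrite diff1E; last exact: dp.
  have [_ e] := is_derive1_powR a (f0 x Ax).
  by rewrite derive1E e -mulrC.
exact: df.
Qed.

Lemma Ck_onZ k A m (f : 'rV[R]_n -> R) (g : 'rV[R]_n -> 'rV[R]_m) : open A ->
  Ck_on k A f -> Ck_on k A g -> Ck_on k A (fun x => f x *: g x).
Proof.
move=> oA Cf /(Ck_on_coord _ _ oA) Cg; apply/Ck_on_coord => // i.
by under eq_fun do rewrite mxE; exact: Ck_onM.
Qed.

End Ck.

(** By the chain rule the derivative is a sum of products of components of ['D_v h] with partial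
    derivatives of [f] composed with [h], to which the induction applies. *)
Lemma Ck_on_comp (R : realType) m n k (A : set 'rV[R]_m) (B : set 'rV[R]_n)
    (h : 'rV[R]_m -> 'rV[R]_n) (f : 'rV[R]_n -> R) : open A -> open B ->
  (forall x, A x -> B (h x)) -> Ck_on k A h -> Ck_on k B f ->
  Ck_on k A (f \o h).
Proof.
move=> oA oB AB; elim: k f => [|k IH] f.
  by move=> ch cf x Ax; apply: continuous_comp; [exact: ch|exact/cf/AB].
move=> Ch [df Df]; have [dh Dh] := Ch; split=> [x Ax|v].
  by apply: differentiable_comp; [exact: dh|exact/df/AB].
have : Ck_on k A (fun x =>
    \sum_i 'D_v h x 0 i * ('D_(delta_mx 0 i) f \o h) x).
  apply: Ck_on_sum => // i _; apply: Ck_onM => //.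
    by have /(Ck_on_coord _ _ oA) := Dh v; exact.
  by apply: IH (Df _); exact: Ck_onW.
apply: Ck_on_eq => // x Ax.
rewrite [RHS]deriveE; last by apply: differentiable_comp; [exact: dh|exact/df/AB].
rewrite diff_row_comp; [|exact: dh|exact/df/AB].
apply: eq_bigr => i _ /=; rewrite !deriveE //; [exact/df/AB|exact: dh].
Qed.

Lemma Ck_on_comp_row (R : realType) m n p k (A : set 'rV[R]_m)
    (B : set 'rV[R]_n) (h : 'rV[R]_m -> 'rV[R]_n) (f : 'rV[R]_n -> 'rV[R]_p) :
  open A -> open B ->
  (forall x, A x -> B (h x)) -> Ck_on k A h -> Ck_on k B f ->
  Ck_on k A (f \o h).
Proof.
move=> oA oB AB Ch /(Ck_on_coord _ _ oB) Cf; apply/(Ck_on_coord _ _ oA) => i.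
exact: (Ck_on_comp oA oB AB Ch (Cf i)).
Qed.

(** * Charts, smooth fields and metrics *)

Section Charts.
Variables (R : realType) (n : nat) (N : manifold R n).
Implicit Types (p q : N) (a b c : chart R n N) (U : set N) (X Y : vfield N).

Lemma open_cmap_image a U : open U -> open (cmap a @` (cdom a `&` U)).
Proof.
move=> oU; rewrite openE => x [q [aq Uq] <-].
have ax : (cmap a @` cdom a) (cmap a q) by exists q.
have n1 : nbhs (cmap a q) (cmap a @` cdom a).
  by apply: open_nbhs_nbhs; split=> //; exact: cimg_open.
have n2 : nbhs (cmap a q) (cinv a @^-1` U).
  apply: (cinv_continuous ax); apply: open_nbhs_nbhs; split=> //.
  by rewrite cmapK.
apply: filterS2 n1 n2 => _ [r ar <-] /=; rewrite cmapK // => Ur.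
by exists r.
Qed.

Lemma cmap_image_sub a U U' : U' `<=` U ->
  cmap a @` (cdom a `&` U') `<=` cmap a @` (cdom a `&` U).
Proof. by move=> UU' x [q [aq Uq] <-]; exists q => //; split=> //; exact: UU'. Qed.

(** The Jacobian of a change of charts. Both [coords] and [coord_field] are instances, from and to
    the chosen chart, so their rules all follow from the cocycle identity [transition_comp]. *)
Definition transition a b q : 'rV[R]_n -> 'rV[R]_n :=
  'd (cmap b \o cinv a) (cmap a q).

Lemma differentiable_transition a b q : atlas a -> atlas b ->
  cdom a q -> cdom b q -> differentiable (cmap b \o cinv a) (cmap a q).
Proof.
move=> Aa Ab aq bq; have [+ _] := atlas_smooth Aa Ab 1; apply.
by exists q.
Qed.

Lemma near_chart a q (P : 'rV[R]_n -> Prop) U : open U -> cdom a q -> U q ->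
  (forall r, cdom a r -> U r -> P (cmap a r)) -> \forall x \near cmap a q, P x.
Proof.
move=> oU aq Uq UP; apply: (@open_near _ _ (cmap a @` (cdom a `&` U))).
- exact: open_cmap_image.
- by exists q.
- by move=> _ [r [ar Ur] <-]; exact: UP.
Qed.

Lemma diff_change_chart (W : normedModType R) (f : N -> W) a b q v :
  atlas a -> atlas b -> cdom a q -> cdom b q ->
  differentiable (f \o cinv b) (cmap b q) ->
  'd (f \o cinv a) (cmap a q) v =
  'd (f \o cinv b) (cmap b q) (transition a b q v).
Proof.
move=> Aa Ab aq bq df.
apply: (@near_eq_diff_comp _ _ _ _ (cmap b \o cinv a) (f \o cinv b)) => //.
- by rewrite /= cmapK.
- exact: differentiable_transition.
apply: (near_chart (U := cdom b)) => // [|r ar br]; first exact: cdom_open.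
by rewrite /= cmapK // cmapK.
Qed.

Lemma transition_comp a b c q v : atlas a -> atlas b -> atlas c ->
  cdom a q -> cdom b q -> cdom c q ->
  transition b c q (transition a b q v) = transition a c q v.
Proof.
move=> Aa Ab Ac aq bq cq; have dc := differentiable_transition Ab Ac bq cq.
exact: esym (diff_change_chart (f := cmap c) v Aa Ab aq bq dc).
Qed.

Lemma transition_id a q v : cdom a q -> transition a a q v = v.
Proof.
move=> aq; apply: near_eq_diff_id.
apply: (near_chart (U := setT)) => // [|r ar _]; first exact: openT.
by rewrite /= cmapK.
Qed.

Lemma coordsD a p (u v : 'rV[R]_n) :
  coords a (u + v : tangent p) =
  coords a (u : tangent p) + coords a (v : tangent p).
Proof. by rewrite /coords linearD. Qed.

Lemma coordsZ a p k (u : 'rV[R]_n) :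
  coords a (k *: u : tangent p) = k *: coords a (u : tangent p).
Proof. by rewrite /coords linearZ. Qed.

Lemma coords_chart_at p (v : tangent p) : coords (chart_at p) v = v.
Proof. by apply: transition_id; exact: chart_at_dom. Qed.

Lemma coords_transition a b p (v : tangent p) : atlas a -> atlas b ->
  cdom a p -> cdom b p -> transition a b p (coords a v) = coords b v.
Proof.
move=> Aa Ab ap bp; apply: transition_comp => //.
  exact: chart_at_atlas.
exact: chart_at_dom.
Qed.

Lemma coords_coord_field a p i : atlas a -> cdom a p ->
  coords a (coord_field a i p) = delta_mx 0 i.
Proof.
move=> Aa ap; rewrite -[RHS](transition_id _ ap).
apply: (@transition_comp a (chart_at p) a) => //.
  exact: chart_at_atlas.
exact: chart_at_dom.
Qed.

Lemma coords_expand a p (v : tangent p) : atlas a -> cdom a p ->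
  v = \sum_i coords a v 0 i *: (coord_field a i p : 'rV[R]_n).
Proof.
move=> Aa ap.
transitivity (transition a (chart_at p) p (coords a v)).
  rewrite coords_transition ?coords_chart_at //; first exact: chart_at_atlas.
  exact: chart_at_dom.
rewrite {1}(row_sum_delta (coords a v)) /transition linear_sum.
by apply: eq_bigr => i _; rewrite linearZ.
Qed.

Lemma coord_field_chart_at p i : coord_field (chart_at p) i p = delta_mx 0 i.
Proof. by apply: transition_id; exact: chart_at_dom. Qed.

End Charts.

Arguments open_cmap_image {R n N} a {U}.

(** * Smooth functions and vector fields on a manifold *)

Section Smoothness.
Variables (R : realType) (n : nat) (N : manifold R n).
Implicit Types (p q : N) (a b c : chart R n N) (U : set N) (X Y : vfield N).

Lemma smooth_vfield_sub U U' X : U' `<=` U ->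
  smooth_vfield U X -> smooth_vfield U' X.
Proof.
by move=> UU' sf a Aa k; apply: Ck_on_sub (sf a Aa k); exact: cmap_image_sub UU'.
Qed.

Lemma eq_smooth_fun U (f h : N -> R) : open U ->
  (forall q, U q -> f q = h q) -> smooth_fun U f -> smooth_fun U h.
Proof.
move=> oU fh sf a Aa k; apply: Ck_on_eq (sf a Aa k); first exact: open_cmap_image.
by move=> _ [q [aq Uq] <-]; rewrite /= cmapK // fh.
Qed.

Lemma eq_smooth_vfield U X Y : open U ->
  (forall q, U q -> X q = Y q) -> smooth_vfield U X -> smooth_vfield U Y.
Proof.
move=> oU XY sX a Aa k; apply: Ck_on_eq (sX a Aa k); first exact: open_cmap_image.
by move=> _ [q [aq Uq] <-]; rewrite cmapK // XY.
Qed.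

Lemma smooth_fun_cst U (c : R) : smooth_fun U (fun=> c).
Proof. by move=> a Aa k; exact: Ck_on_cst. Qed.

Lemma smooth_funM U (f h : N -> R) : open U ->
  smooth_fun U f -> smooth_fun U h -> smooth_fun U (fun q => f q * h q).
Proof.
move=> oU sf sh a Aa k; apply: Ck_onM (sf a Aa k) (sh a Aa k).
exact: open_cmap_image.
Qed.

Lemma smooth_fun_powR U (f : N -> R) (r : R) : open U ->
  (forall q, U q -> 0 < f q) -> smooth_fun U f ->
  smooth_fun U (fun q => f q `^ r).
Proof.
move=> oU f0 sf a Aa k; apply: Ck_on_powR (sf a Aa k).
  exact: open_cmap_image.
by move=> _ [q [aq Uq] <-] /=; rewrite cmapK // f0.
Qed.

Lemma smooth_vfieldZ U (f : N -> R) X : open U ->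
  smooth_fun U f -> smooth_vfield U X ->
  smooth_vfield U (fun q => f q *: (X q : 'rV[R]_n)).
Proof.
move=> oU sf sX a Aa k; under eq_fun do rewrite coordsZ.
apply: Ck_onZ (sf a Aa k) (sX a Aa k); exact: open_cmap_image.
Qed.

Lemma smooth_vfieldD U X Y : open U ->
  smooth_vfield U X -> smooth_vfield U Y ->
  smooth_vfield U (fun q => (X q : 'rV[R]_n) + Y q).
Proof.
move=> oU sX sY a Aa k; under eq_fun do rewrite coordsD.
apply: Ck_onD (sX a Aa k) (sY a Aa k); exact: open_cmap_image.
Qed.

Lemma smooth_vfield0 U : smooth_vfield U (fun=> 0 : 'rV[R]_n).
Proof.
move=> a Aa k; rewrite (_ : (fun x => _) = fun=> 0).
  exact: Ck_on_cst.
by apply/funext => x; rewrite /coords linear0.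
Qed.

Lemma smooth_vfield_sum U (I : Type) (r : seq I) (P : pred I)
    (X : I -> vfield N) : open U ->
  (forall i, P i -> smooth_vfield U (X i)) ->
  smooth_vfield U (fun q => \sum_(i <- r | P i) (X i q : 'rV[R]_n)).
Proof.
move=> oU sX; elim: r => [|i r IH].
  by under eq_fun do rewrite big_nil; exact: smooth_vfield0.
under eq_fun do rewrite big_cons.
by have [/sX sXi|//] := boolP (P i); exact: smooth_vfieldD oU sXi IH.
Qed.

Lemma smooth_fun_chart c U (f : N -> R) : atlas c -> open U -> U `<=` cdom c ->
  smooth_on (cmap c @` (cdom c `&` U)) (f \o cinv c) -> smooth_fun U f.
Proof.
move=> Ac oU Uc sf a Aa k.
have oaU := open_cmap_image a oU; have ocU := open_cmap_image c oU.
apply: (@Ck_on_eq _ _ _ _ _ ((f \o cinv c) \o (cmap c \o cinv a))) => //.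
  by move=> _ [q [aq Uq] <-] /=; rewrite cmapK // cmapK //; exact: Uc.
apply: Ck_on_comp oaU ocU _ _ (sf k).
  by move=> _ [q [aq Uq] <-] /=; exists q; rewrite ?cmapK //; split=> //; exact: Uc.
by apply: Ck_on_sub (atlas_smooth Aa Ac k); exact: cmap_image_sub Uc.
Qed.

Lemma smooth_vfield_chart c U X : atlas c -> open U -> U `<=` cdom c ->
  smooth_on (cmap c @` (cdom c `&` U)) (fun x => coords c (X (cinv c x))) ->
  smooth_vfield U X.
Proof.
move=> Ac oU Uc sX a Aa k.
have oaU := open_cmap_image a oU.
have oUa : open (U `&` cdom a) by apply: openI => //; exact: cdom_open.
have ocU := open_cmap_image c oUa.
(* The components in the chart [a], as a function of the coordinates of [c]: the Jacobian applied to
   the components in [c]. *)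
pose F x := \sum_i coords c (X (cinv c x)) 0 i *:
  ('D_(delta_mx 0 i) (cmap a \o cinv c) x : 'rV[R]_n).
have CF : Ck_on k (cmap c @` (cdom c `&` (U `&` cdom a))) F.
  apply: Ck_on_sum => // i _; apply: Ck_onZ => //.
    apply: ((Ck_on_coord _ _ ocU).1 _ i); apply: Ck_on_sub (sX k).
    by apply: cmap_image_sub => q [].
  (* The Jacobian costs one derivative, hence the order [k.+1]. *)
  have [_ /(_ (delta_mx 0 i))] := atlas_smooth Ac Aa k.+1.
  by apply: Ck_on_sub; apply: cmap_image_sub => q [].
apply: (@Ck_on_eq _ _ _ _ _ (F \o (cmap c \o cinv a))) => //; last first.
  apply: Ck_on_comp_row oaU ocU _ _ CF.
    move=> _ [q [aq Uq] <-] /=; exists q; rewrite ?cmapK //.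
    by split=> //; exact: Uc.
  by apply: Ck_on_sub (atlas_smooth Aa Ac k); exact: cmap_image_sub Uc.
move=> _ [q [aq Uq] <-]; have cq := Uc q Uq.
rewrite /F /= cmapK // cmapK // -(coords_transition _ Ac Aa cq aq).
rewrite {2}(row_sum_delta (coords c (X q))) /transition linear_sum.
apply: eq_bigr => i _; rewrite linearZ deriveE //.
exact: differentiable_transition.
Qed.

Lemma smooth_coord_field c U i : atlas c -> open U -> U `<=` cdom c ->
  smooth_vfield U (coord_field c i).
Proof.
move=> Ac oU Uc; apply: (smooth_vfield_chart Ac oU Uc) => k.
apply: (@Ck_on_eq _ _ _ _ _ (fun=> delta_mx 0 i)); last exact: Ck_on_cst.
  exact: open_cmap_image.
by move=> _ [q [cq Uq] <-]; rewrite cmapK // coords_coord_field.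
Qed.

Lemma smooth_coords c U X i : atlas c -> open U -> U `<=` cdom c ->
  smooth_vfield U X -> smooth_fun U (fun q => coords c (X q) 0 i).
Proof.
move=> Ac oU Uc sX; apply: (smooth_fun_chart Ac oU Uc) => k.
have ocU := open_cmap_image c oU.
exact: ((Ck_on_coord _ _ ocU).1 (sX c Ac k) i).
Qed.

End Smoothness.

(** * Inner products of vectors and of smooth fields *)

Section Inner.
Variables (R : realType) (n : nat) (N : manifold R n) (g : metric N).
Implicit Types (p q : N) (U : set N).

Lemma innerDl p (u v w : 'rV[R]_n) :
  inner g (u + v : tangent p) w =
  inner g (u : tangent p) w + inner g (v : tangent p) w.
Proof. by rewrite /inner !mulmxDl mxE. Qed.

Lemma innerZl p k (u w : 'rV[R]_n) :
  inner g (k *: u : tangent p) w = k * inner g (u : tangent p) w.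
Proof. by rewrite /inner -!scalemxAl mxE. Qed.

Lemma inner_sym p (u v : 'rV[R]_n) :
  inner g (u : tangent p) v = inner g (v : tangent p) u.
Proof.
rewrite /inner; have -> : v *m gram g p *m u^T = (u *m gram g p *m v^T)^T.
  by rewrite !trmx_mul trmxK gram_sym mulmxA.
by rewrite [RHS]mxE.
Qed.

Lemma innerBl p (u v w : 'rV[R]_n) :
  inner g (u - v : tangent p) w =
  inner g (u : tangent p) w - inner g (v : tangent p) w.
Proof. by rewrite innerDl -scaleN1r innerZl mulN1r. Qed.

Lemma inner_suml p (I : Type) (r : seq I) (P : pred I) (u : I -> 'rV[R]_n)
    (w : 'rV[R]_n) :
  inner g (\sum_(i <- r | P i) u i : tangent p) w =
  \sum_(i <- r | P i) inner g (u i : tangent p) w.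
Proof.
elim/big_rec2: _ => [|i y x _ <-]; last by rewrite innerDl.
by rewrite /inner !mul0mx mxE.
Qed.

Lemma inner_sumr p (I : Type) (r : seq I) (P : pred I) (u : I -> 'rV[R]_n)
    (w : 'rV[R]_n) :
  inner g (w : tangent p) (\sum_(i <- r | P i) u i) =
  \sum_(i <- r | P i) inner g (w : tangent p) (u i).
Proof.
by rewrite inner_sym inner_suml; apply: eq_bigr => i _; rewrite inner_sym.
Qed.

Lemma innerZr p k (u w : 'rV[R]_n) :
  inner g (w : tangent p) (k *: u) = k * inner g (w : tangent p) u.
Proof. by rewrite inner_sym innerZl inner_sym. Qed.

Lemma smooth_inner U (X Y : vfield N) : open U ->
  smooth_vfield U X -> smooth_vfield U Y ->
  smooth_fun U (fun q => inner g (X q) (Y q)).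
Proof.
move=> oU sX sY a Aa k; have oaU := open_cmap_image a oU.
pose F x := \sum_i \sum_j coords a (X (cinv a x)) 0 i *
  (coords a (Y (cinv a x)) 0 j *
   inner g (coord_field a i (cinv a x)) (coord_field a j (cinv a x))).
apply: (@Ck_on_eq _ _ _ _ _ F) => //.
  move=> _ [q [aq Uq] <-]; rewrite /F /= cmapK //.
  rewrite [in RHS](coords_expand (X q) Aa aq) [in RHS](coords_expand (Y q) Aa aq).
  rewrite inner_suml; apply: eq_bigr => i _.
  by rewrite innerZl inner_sumr mulr_sumr; apply: eq_bigr => j _; rewrite innerZr.
apply: Ck_on_sum => // i _; apply: Ck_on_sum => // j _.
apply: Ck_onM => //; first exact: ((Ck_on_coord _ _ oaU).1 (sX a Aa k) i).
apply: Ck_onM => //; first exact: ((Ck_on_coord _ _ oaU).1 (sY a Aa k) j).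
apply: Ck_on_sub (gram_smooth g Aa i j k).
by move=> _ [q [aq _] <-]; exists q.
Qed.

(** With the [X i] as rows of [B] and [G] the Gram matrix, orthonormality says that [G *m B^T] is a
    right inverse of [B]. For square matrices it is also a left inverse, which is the expansion. *)
Lemma orthonormal_expand p (X : 'I_n -> 'rV[R]_n) (v : 'rV[R]_n) :
  (forall i j, inner g (X i : tangent p) (X j) = (i == j)%:R) ->
  v = \sum_i inner g (v : tangent p) (X i) *: X i.
Proof.
move=> oX; pose B : 'M[R]_n := \matrix_(i, j) X i 0 j.
have rowB i : row i B = X i by apply/rowP => j; rewrite !mxE.
have B1 : B *m (gram g p *m B^T) = 1%:M.
  apply/matrixP => i j; rewrite mulmxA [RHS]mxE -oX /inner !mxE.
  apply: eq_bigr => k _; rewrite !mxE; congr (_ * _).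
  by apply: eq_bigr => l _; rewrite !mxE.
have /mulmx1C B2 := B1.
rewrite -[LHS]mulmx1 -B2 mulmxA mulmx_sum_row; apply: eq_bigr => i _.
rewrite rowB /inner; congr (_ *: _); rewrite mulmxA !mxE.
by apply: eq_bigr => k _; rewrite !mxE.
Qed.

End Inner.

(** * Torsion-free connections *)

Section Connection.
Variables (R : realType) (n : nat) (N : manifold R n).
Implicit Types (p q : N) (U : set N) (X Y : vfield N).

Lemma dfun_near_cst p U (f : N -> R) (c : R) (v : tangent p) :
  open_nbhs p U -> (forall q, U q -> f q = c) -> dfun f v = 0.
Proof.
move=> [oU Up] fc; apply: (near_eq_diff_cst (c := c)).
apply: (near_chart (U := U)) => //; first exact: chart_at_dom.
by move=> r ar Ur /=; rewrite cmapK // fc.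
Qed.

(** Stated without a metric, so that the connections of two metrics can be compared through it. *)
Definition torsion_free (nabla : connection_op N) := forall p U X Y,
  open_nbhs p U -> smooth_vfield U X -> smooth_vfield U Y ->
  (nabla p (X p) Y : 'rV[R]_n) - nabla p (Y p) X = bracket X Y p.

Section OneConnection.
Variables (nabla : connection_op N) (nablaP : is_connection nabla).

(* Multiplying by the indicator function of U, which is smooth on U, makes two
   fields that agree on U equal. *)
Lemma nabla_local p U (v : tangent p) X Y : open_nbhs p U ->
  smooth_vfield U X -> (forall q, U q -> X q = Y q) ->
  nabla v X = nabla v Y.
Proof.
move=> pU sX XY; have [oU Up] := pU.
have sY : smooth_vfield U Y by exact: eq_smooth_vfield oU XY sX.
pose f : N -> R := \1_U.
have f1 q : U q -> f q = 1 by move=> Uq; rewrite /f indicE mem_set.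
have sf : smooth_fun U f.
  by apply: (eq_smooth_fun oU _ (smooth_fun_cst U 1)) => q /f1.
have fXY : (fun q => f q *: (X q : 'rV[R]_n)) =
    (fun q => f q *: (Y q : 'rV[R]_n)).
  apply: functional_extensionality_dep => q.
  have [Uq|nUq] := pselect (U q); first by rewrite XY.
  by rewrite /f indicE memNset // !scale0r.
have nf Z : smooth_vfield U Z ->
    nabla v (fun q => f q *: (Z q : 'rV[R]_n)) = nabla v Z.
  move=> sZ; rewrite (nabla_leibniz nablaP v pU sf sZ).
  by rewrite (dfun_near_cst v pU f1) scale0r add0r f1 // scale1r.
by rewrite -(nf X) // fXY nf.
Qed.

Lemma nabla0 p (v : tangent p) : nabla v (fun=> 0 : 'rV[R]_n) = 0 :> 'rV[R]_n.
Proof.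
have pT : open_nbhs p setT by split; [exact: openT|].
have s0 := @smooth_vfield0 R n N setT.
have := nabla_add nablaP v pT s0 s0.
rewrite (_ : (fun q => _ + _) = (fun q : N => 0 : 'rV[R]_n)).
  by move/eqP; rewrite -[X in X == _]addr0 (inj_eq (addrI _)) => /eqP.
by apply/funext => q; rewrite addr0.
Qed.

Lemma nabla_sum p U (v : tangent p) (I : Type) (r : seq I) (f : I -> N -> R)
    (Y : I -> vfield N) : open_nbhs p U ->
  (forall i, smooth_fun U (f i)) -> (forall i, smooth_vfield U (Y i)) ->
  nabla v (fun q => \sum_(i <- r) f i q *: (Y i q : 'rV[R]_n)) =
  \sum_(i <- r) (dfun (f i) v *: (Y i p : 'rV[R]_n) +
                 f i p *: (nabla v (Y i) : 'rV[R]_n)) :> 'rV[R]_n.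
Proof.
move=> pU sf sY; have [oU _] := pU; elim: r => [|i r IH].
  rewrite big_nil (_ : (fun q => _) = (fun q : N => 0 : 'rV[R]_n)) ?nabla0 //.
  by apply/funext => q; rewrite big_nil.
rewrite big_cons -IH -(nabla_leibniz nablaP v pU (sf i) (sY i)).
rewrite -(nabla_add nablaP v pU); first last.
- by apply: smooth_vfield_sum => // j _; exact: smooth_vfieldZ.
- exact: smooth_vfieldZ.
congr (nabla v _ : 'rV[R]_n).
by apply: functional_extensionality_dep => q; rewrite big_cons.
Qed.

Lemma nabla_suml p (I : Type) (r : seq I) (c : I -> R) (u : I -> 'rV[R]_n) X :
  nabla (\sum_(i <- r) c i *: u i : tangent p) X =
  \sum_(i <- r) c i *: (nabla (u i : tangent p) X : 'rV[R]_n) :> 'rV[R]_n.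
Proof.
elim: r => [|i r IH]; last by rewrite !big_cons (nabla_linear nablaP) IH.
rewrite !big_nil; have := nabla_linear nablaP (p := p) 1 0 0 X.
rewrite scaler0 addr0 scale1r.
by move/eqP; rewrite -[X in X == _]addr0 (inj_eq (addrI _)) => /eqP.
Qed.

(** Leibniz rule for the expansion of [X] in coordinate fields, valid near [p]. The terms with
    [dfun] are common to all connections; the others carry the Christoffel symbols. *)
Lemma nabla_coords p U (v : tangent p) X : open_nbhs p U ->
  smooth_vfield U X ->
  nabla v X = \sum_i (dfun (fun q => coords (chart_at p) (X q) 0 i) v
                        *: delta_mx 0 i +
    (X p : 'rV[R]_n) 0 i *: (nabla v (coord_field (chart_at p) i) : 'rV[R]_n))
  :> 'rV[R]_n.
Proof.
move=> [oU Up] sX; pose c := chart_at p.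
have Ac : atlas c by exact: chart_at_atlas.
have cp : cdom c p by exact: chart_at_dom.
pose U' := U `&` cdom c.
have oU' : open U' by apply: openI => //; exact: cdom_open.
have pU' : open_nbhs p U' by [].
have U'c : U' `<=` cdom c by move=> q [].
have sX' : smooth_vfield U' X by apply: smooth_vfield_sub sX => q [].
rewrite (@nabla_local p U' v X (fun q => \sum_i coords c (X q) 0 i *:
  (coord_field c i q : 'rV[R]_n)) pU' sX'); last first.
  by move=> q [_ cq]; exact: coords_expand.
rewrite (nabla_sum v _ pU').
- by apply: eq_bigr => i _; rewrite coords_chart_at coord_field_chart_at.
- by move=> i; exact: smooth_coords.
- by move=> i; exact: smooth_coord_field.
Qed.

(** Coordinate fields have constant local expressions, so their bracket at [p] vanishes. *)
Lemma nabla_coord_field_sym p i j :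
  torsion_free nabla ->
  let c := chart_at p in
  nabla (delta_mx 0 i : tangent p) (coord_field c j) =
  nabla (delta_mx 0 j : tangent p) (coord_field c i).
Proof.
move=> tf c; have Ac : atlas c by exact: chart_at_atlas.
have cp : cdom c p by exact: chart_at_dom.
have pc : open_nbhs p (cdom c) by split; [exact: cdom_open|].
have sc k : smooth_vfield (cdom c) (coord_field c k).
  by apply: smooth_coord_field => //; exact: cdom_open.
have := tf _ _ _ _ pc (sc i) (sc j).
rewrite !coord_field_chart_at => e; apply/subr0_eq; rewrite {}e.
have d0 k u : 'd (local_expr p (coord_field c k)) (pos p) u = 0.
  apply: (near_eq_diff_cst (c := delta_mx 0 k)).
  apply: (near_chart (U := cdom c)) => //; first exact: cdom_open.
  by move=> r cr _; rewrite /local_expr cmapK // coords_coord_field.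
exact: etrans (congr2 (fun u v : 'rV[R]_n => u - v) (d0 j _) (d0 i _)) (subr0 0).
Qed.

End OneConnection.

End Connection.

Section Along.
Variables (R : realType) (m n : nat) (M : manifold R m) (N : manifold R n).
Variable Phi : M -> N.

(* The Christoffel symbols of a torsion-free connection cancel out: the
   right-hand side does not involve nabla. *)
Lemma nabla_along_sub (nabla : connection_op N) (V : field_along Phi)
    (p : M) (w : tangent p) (U : set N) (X : 'I_n -> vfield N) (A : 'I_n -> R) :
  is_connection nabla -> torsion_free nabla ->
  open_nbhs (Phi p) U -> (forall i, smooth_vfield U (X i)) ->
  dmap Phi w = \sum_i A i *: (X i (Phi p) : 'rV[R]_n) ->
  let c := chart_at (Phi p) in
  (nabla_along nabla V w : 'rV[R]_n) -
    \sum_i A i *: (nabla (Phi p) (V p) (X i) : 'rV[R]_n) =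
  'd (fun x => coords c (V (cinv (chart_at p) x))) (pos p) w -
  \sum_i A i *: (\sum_l dfun (fun q => coords c (X i q) 0 l) (V p)
                            *: (delta_mx 0 l : 'rV[R]_n)).
Proof.
move=> nablaP tf pU sX eX c.
(* For [u] a unit row, these are the Christoffel symbols at [Phi p] in the chosen chart. *)
pose D (u : 'rV[R]_n) l : 'rV[R]_n := nabla (Phi p) u (coord_field c l).
have sumD u l : D u l = \sum_k u 0 k *: D (delta_mx 0 k) l.
  by rewrite {1}/D {1}(row_sum_delta u) nabla_suml.
have symD k l : D (delta_mx 0 k) l = D (delta_mx 0 l) k.
  exact: nabla_coord_field_sym.
rewrite /nabla_along -/c -addrA; congr (_ + _).
have -> : \sum_i A i *: (nabla (Phi p) (V p) (X i) : 'rV[R]_n) =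
    \sum_i A i *: (\sum_l dfun (fun q => coords c (X i q) 0 l) (V p)
                            *: (delta_mx 0 l : 'rV[R]_n)) +
    \sum_l (dmap Phi w : 'rV[R]_n) 0 l *: D (V p) l.
  rewrite eX.
  under [X in _ = _ + X]eq_bigr do rewrite summxE scaler_suml.
  rewrite exchange_big -big_split; apply: eq_bigr => i _ /=.
  rewrite (nabla_coords nablaP _ pU (sX i)) -/c big_split scalerDr; congr (_ + _).
  by rewrite scaler_sumr; apply: eq_bigr => l _; rewrite mxE scalerA.
rewrite opprD addrCA -[RHS]addr0; congr (_ + _); apply/eqP.
rewrite subr_eq0; apply/eqP.
(* What remains are the Christoffel symbols contracted with [V p] and [dmap Phi w] in the two
   possible orders, equal by symmetry. *)
transitivity (\sum_l \sum_k ((V p : 'rV[R]_n) 0 l *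
  (dmap Phi w : 'rV[R]_n) 0 k) *: D (delta_mx 0 k) l).
  apply: eq_bigr => l _; rewrite -/(D _ l) sumD scaler_sumr.
  by apply: eq_bigr => k _; rewrite scalerA.
rewrite exchange_big; apply: eq_bigr => l _ /=; rewrite sumD scaler_sumr.
by apply: eq_bigr => k _; rewrite scalerA symD mulrC.
Qed.

End Along.

(** * The admissibility equations and adapted frames *)

Section Multivectors.
Variables (R : realType) (m n : nat) (N : manifold R n) (g : metric N) (p : N).
Implicit Types (v w e : 'I_m -> 'rV[R]_n).

Lemma inner_delta i j :
  inner g (delta_mx 0 i : tangent p) (delta_mx 0 j) = gram g p i j.
Proof. by rewrite /inner -rowE trmx_delta -colE !mxE. Qed.

(** The matrix of inner products is a product of three factors, with the Gram matrix in the middle;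
    applying Cauchy-Binet twice yields the double sum of [inner_mvec]. *)
Lemma inner_mvec_wedge v w :
  inner_mvec g p (wedge v) (wedge w) =
  \det (\matrix_(a, b) inner g (v a : tangent p) (w b)).
Proof.
pose Vm : 'M[R]_(m, n) := \matrix_(a, i) v a 0 i.
pose Wm : 'M[R]_(m, n) := \matrix_(a, i) w a 0 i.
have -> : \matrix_(a, b) inner g (v a : tangent p) (w b) =
    Vm *m (gram g p *m Wm^T).
  apply/matrixP => a b; rewrite mulmxA /inner !mxE; apply: eq_bigr => k _.
  rewrite !mxE; congr (_ * _); apply: eq_bigr => l _; by rewrite mxE.
rewrite cauchy_binet; apply: eq_bigr => I _.
have -> : rowsub (val I) (gram g p *m Wm^T) = rowsub (val I) (gram g p) *m Wm^T.
  by apply/matrixP => a b; rewrite !mxE; apply: eq_bigr => k _; rewrite !mxE.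
rewrite cauchy_binet mulr_sumr; apply: eq_bigr => J _.
rewrite -mulrA [_ * \det _]mulrC; congr (_ * (_ * _)).
- rewrite ffunE; apply: (congr1 (fun B : 'M[R]_m => \det B)).
  by apply/matrixP => a b; rewrite !mxE.
- rewrite ffunE -det_tr; apply: (congr1 (fun B : 'M[R]_m => \det B)).
  by apply/matrixP => a b; rewrite !mxE.
- by congr (\det _); apply/matrixP => a b; rewrite !mxE inner_delta.
Qed.

Lemma mvector_sumE (I : Type) (r : seq I) (eta : I -> mvector R m n) J :
  (\sum_(k <- r) eta k : mvector R m n) J = \sum_(k <- r) (eta k J : R).
Proof. by elim/big_rec2: _ => [|k x y _ <-]; rewrite ffunE. Qed.

Lemma inner_mvec_sumr xi (I : Type) (r : seq I) (eta : I -> mvector R m n) :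
  inner_mvec g p xi (\sum_(k <- r) eta k) =
  \sum_(k <- r) inner_mvec g p xi (eta k).
Proof.
rewrite /inner_mvec [RHS]exchange_big; apply: eq_bigr => K _.
rewrite [RHS]exchange_big; apply: eq_bigr => J _.
by rewrite mvector_sumE [xi K * _]mulr_sumr mulr_suml.
Qed.

Lemma inner_mvec_suml eta (I : Type) (r : seq I) (c : I -> R)
    (xi : I -> mvector R m n) :
  inner_mvec g p (\sum_(k <- r) c k *: xi k) eta =
  \sum_(k <- r) c k * inner_mvec g p (xi k) eta.
Proof.
under [RHS]eq_bigr do rewrite /inner_mvec mulr_sumr.
rewrite [RHS]exchange_big; apply: eq_bigr => K _ /=.
under [RHS]eq_bigr do rewrite mulr_sumr.
rewrite [RHS]exchange_big; apply: eq_bigr => J _ /=.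
rewrite mvector_sumE !mulr_suml; apply: eq_bigr => k _.
by rewrite ffunE -!mulrA.
Qed.

(** The terms with [De] replace one row of the matrix of inner products, those with [nabla_wedge]
    one column; both are derivatives of the same minor. *)
Lemma admissibility_dminor (nabla : connection_op N) (u : tangent p)
    e (De : 'I_m -> 'rV[R]_n) (X : 'I_n -> vfield N) (J : multi_index m n) :
  inner_mvec g p (wedge e) (nabla_wedge nabla u (fun a => X (val J a))) +
  \sum_(k < m) inner_mvec g p (wedge_at e k (De k))
                              (wedge (fun a => X (val J a) p)) =
  dminor (\matrix_(k, j) inner g (e k : tangent p) (X j p))
    (\matrix_(k, j) (inner g (De k : tangent p) (X j p) +
                     inner g (e k : tangent p) (nabla p u (X j)))) (val J).
Proof.
set A := (X in dminor X).
pose W1 := \matrix_(k < m, j < n) inner g (De k : tangent p) (X j p).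
pose W2 := \matrix_(k < m, j < n) inner g (e k : tangent p) (nabla p u (X j)).
have -> : \matrix_(k, j) (inner g (De k : tangent p) (X j p) +
    inner g (e k : tangent p) (nabla p u (X j))) = W1 + W2.
  by apply/matrixP => k j; rewrite !mxE.
rewrite dminorD addrC; congr (_ + _).
  apply: eq_bigr => k _; rewrite inner_mvec_wedge; congr (\det _).
  by apply/matrixP => a b; rewrite !mxE; case: eqP => // ->.
rewrite inner_mvec_sumr dminor_col; apply: eq_bigr => k _.
rewrite inner_mvec_wedge; congr (\det _).
by apply/matrixP => a b; rewrite !mxE; case: eqP => // ->.
Qed.

End Multivectors.

(** * Adapted frames and Gram-Schmidt orthonormalization *)

Section Frames.
Variables (R : realType) (n : nat) (N : manifold R n) (H : gradation N).
Implicit Types (p q : N) (U : set N) (X Y : 'I_n -> vfield N).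

Lemma deg_leP p (j : 'I_n) i : (j < \dim (H i p))%N -> (deg H p j <= i)%N.
Proof. by rewrite /deg; case: ex_minnP => k _; exact. Qed.

Lemma deg_dim p (j : 'I_n) : (j < \dim (H (deg H p j) p))%N.
Proof. by rewrite /deg; case: ex_minnP. Qed.

(** With [s] the degree of [i], the vector [X i q] lies in [H s q], spanned by those [Y k q] that
    precede every index of higher degree. Degrees are read at [p] and vectors at [q]; equiregularity
    links the two. *)
Lemma adapted_orthogonal (g : metric N) p q U U' X Y (i j : 'I_n) :
  equiregular H -> adapted_frame H U X -> adapted_frame H U' Y ->
  U q -> U' q ->
  (forall k l, inner g (Y k q) (Y l q) = (k == l)%:R) ->
  (deg H p i < deg H p j)%N -> inner g (X i q) (Y j q) = 0.
Proof.
move=> eqH [_ _ aX] [_ _ aY] Uq U'q oY lt_ij; set s := deg H p i.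
have lt_i : (i < \dim (H s q))%N by rewrite (eqH s q p) deg_dim.
have ge_j : (\dim (H s q) <= j)%N.
  rewrite leqNgt; apply/negP; rewrite (eqH s q p) => /deg_leP.
  by rewrite leqNgt lt_ij.
have : (X i q : 'rV[R]_n) \in H s q.
  rewrite (aX q Uq s); apply/memv_sumP.
  exists (fun k => if k == i then X i q : 'rV[R]_n else 0).
    by move=> k _; case: eqP => [->|_]; rewrite ?memv_line ?mem0v.
  by rewrite (bigD1 i) //= eqxx big1 ?addr0 // => k /andP[_ /negbTE->].
rewrite (aY q U'q s) => /memv_sumP[v vY ->].
rewrite inner_suml big1 // => k lt_k.
have /vlineP[c ->] := vY k lt_k; rewrite innerZl oY.
have [kj|_] := eqVneq k j; last by rewrite mulr0.
by move: lt_k; rewrite kj ltnNge ge_j.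
Qed.

Lemma is_basis_free p (E : 'I_n -> tangent p) (c : 'I_n -> R) :
  is_basis E -> \sum_i c i *: (E i : 'rV[R]_n) = 0 -> forall i, c i = 0.
Proof.
move=> /basis_free/freeP freeE sum0; apply: freeE; rewrite -[RHS]sum0.
by apply: eq_bigr => i _; rewrite (nth_map i) ?size_enum_ord // nth_ord_enum.
Qed.

Lemma gram_schmidt (g : metric N) U X : open U ->
  (forall j, smooth_vfield U (X j)) ->
  (forall q, U q -> is_basis (fun j => X j q)) ->
  exists Y, [/\ forall j, smooth_vfield U (Y j),
    orthonormal_frame g U Y &
    forall q, U q -> forall r : nat,
      (\sum_(j < n | (j < r)%N) <[X j q : 'rV[R]_n]> =
       \sum_(j < n | (j < r)%N) <[Y j q : 'rV[R]_n]>)%VS].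
Proof.
move=> oU sX bX.
have mem_flag (Z : 'I_n -> 'rV[R]_n) r (i : 'I_n) : (i < r)%N ->
    Z i \in (\sum_(j < n | (j < r)%N) <[Z j]>)%VS.
  by move=> lt_ir; rewrite memvE; apply: (sumv_sup i).
have flag_sub (Z Z' : 'I_n -> 'rV[R]_n) (r : nat) :
    (forall j : 'I_n, (j < r)%N ->
      Z j \in (\sum_(i < n | (i < j.+1)%N) <[Z' i]>)%VS) ->
    (\sum_(j < n | (j < r)%N) <[Z j]> <= \sum_(j < n | (j < r)%N) <[Z' j]>)%VS.
  move=> ZZ'; apply/subv_sumP => j lt_jr; rewrite -memvE.
  apply: subvP (ZZ' j lt_jr); apply/subv_sumP => i lt_ij.
  by rewrite -memvE mem_flag // (leq_trans lt_ij lt_jr).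
(* After [k] rounds the first [k] fields are orthonormal and triangular with respect to [X] in both
   directions; the later ones are only kept smooth. *)
have gs (k : nat) : (k <= n)%N -> exists Y : 'I_n -> vfield N,
    [/\ forall j, smooth_vfield U (Y j),
      forall q, U q -> forall i j : 'I_n, (i < k)%N -> (j < k)%N ->
        inner g (Y i q) (Y j q) = (i == j)%:R,
      forall q, U q -> forall j : 'I_n, (j < k)%N ->
        (Y j q : 'rV[R]_n) \in
           (\sum_(i < n | (i < j.+1)%N) <[X i q : 'rV[R]_n]>)%VS
    & forall q, U q -> forall j : 'I_n, (j < k)%N ->
        (X j q : 'rV[R]_n) \in
           (\sum_(i < n | (i < j.+1)%N) <[Y i q : 'rV[R]_n]>)%VS].
  elim: k => [|k IH] lt_kn; first by exists X.
  have [Y [sY oY YX XY]] := IH (ltnW lt_kn).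
  pose o := Ordinal lt_kn.
  (* [X o] minus its projection on the previous fields. The factor [- 1] makes the coefficient a
     product, whose smoothness follows from [smooth_funM]. *)
  pose Z q : 'rV[R]_n := (X o q : 'rV[R]_n) +
    \sum_(i < n | (i < k)%N) (- 1 * inner g (X o q) (Y i q)) *: (Y i q : 'rV[R]_n).
  have sZ : smooth_vfield U Z.
    apply: smooth_vfieldD => //; apply: smooth_vfield_sum => // i _.
    apply: smooth_vfieldZ => //; apply: smooth_funM => //.
      exact: smooth_fun_cst.
    exact: smooth_inner.
  have ZY q (i : 'I_n) : U q -> (i < k)%N -> inner g (Z q : tangent q) (Y i q) = 0.
    move=> Uq lt_ik; rewrite innerDl inner_suml (bigD1 i) //= big1.
      by rewrite innerZl oY // eqxx mulr1 mulN1r addr0 subrr.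
    move=> j /andP[lt_jk /negbTE ne_ji].
    by rewrite innerZl oY // ne_ji mulr0.
  (* Otherwise [X o q] would lie in the span of the earlier [X i q]. *)
  have Z0 q : U q -> Z q != 0.
    move=> Uq; apply/eqP => Zq0.
    have : \sum_(i < n | (i < k)%N)
       (inner g (X o q) (Y i q)) *: (Y i q : 'rV[R]_n) \in
       (\sum_(i < n | (i < k)%N) <[X i q : 'rV[R]_n]>)%VS.
      apply: memv_suml => i lt_ik; apply: memvZ.
      by apply: subvP (flag_sub _ _ k (YX q Uq)) _ _; exact: mem_flag.
    have -> : \sum_(i < n | (i < k)%N)
       (inner g (X o q) (Y i q)) *: (Y i q : 'rV[R]_n) = X o q.
      apply/esym/eqP; rewrite -subr_eq0 -[X in _ == X]Zq0 /Z -sumrN.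
      by apply/eqP; congr (_ + _); apply: eq_bigr => i _; rewrite mulN1r scaleNr.
    move=> /memv_sumP[v vX eXo].
    have cP (i : 'I_n) : {c : R | (i < k)%N -> v i = c *: (X i q : 'rV[R]_n)}.
      apply: cid; have [lt_ik|_] := boolP (i < k)%N; last by exists 0.
      by have /vlineP[c e] := vX i lt_ik; exists c.
    (* A linear relation whose coefficient at [o] is -1, which contradicts freeness. *)
    pose c (i : 'I_n) : R := (if (i < k)%N then sval (cP i) else 0) - (i == o)%:R.
    have sum0 : \sum_i c i *: (X i q : 'rV[R]_n) = 0.
      under eq_bigr do rewrite scalerBl.
      rewrite sumrB [X in _ - X](bigD1 o) //= eqxx scale1r.
      rewrite [X in _ - (_ + X)]big1; last first.
        by move=> i /negbTE->; rewrite scale0r.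
      rewrite addr0 eXo [X in _ - X]big_mkcond /=; apply/eqP; rewrite subr_eq0.
      apply/eqP/eq_bigr => i _; case: ifP => [lt_ik|_]; last by rewrite scale0r.
      exact: esym (svalP (cP i) lt_ik).
    have := is_basis_free (bX q Uq) sum0 o; rewrite /c eqxx.
    case: ifP => [lt_oo|_ /eqP]; first by rewrite /= ltnn in lt_oo.
    by rewrite sub0r oppr_eq0 oner_eq0.
  pose s q := inner g (Z q : tangent q) (Z q).
  have s0 q : U q -> 0 < s q by move=> Uq; apply: gram_pos; exact: Z0.
  have r0 q : U q -> s q `^ (- 2^-1) != 0.
    by move=> Uq; rewrite gt_eqF // powR_gt0 // s0.
  have rs q : U q -> s q `^ (- 2^-1) * (s q `^ (- 2^-1) * s q) = 1.
    move=> Uq; rewrite mulrA -powRD; last by rewrite (gt_eqF (s0 q Uq)) implybT.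
    rewrite -opprD (_ : 2^-1 + 2^-1 = 1) ?powRN ?powRr1 ?ltW ?s0 //.
      by rewrite mulVf // (gt_eqF (s0 q Uq)).
    by rewrite [RHS]splitr !mul1r.
  pose Y' (j : 'I_n) : vfield N :=
    if j == o then (fun q => s q `^ (- 2^-1) *: Z q) else Y j.
  have Y'o q : Y' o q = s q `^ (- 2^-1) *: Z q by rewrite /Y' eqxx.
  have Y'lt (j : 'I_n) : (j < k)%N -> Y' j = Y j.
    by move=> lt_jk; rewrite /Y' ifN //; apply/eqP => jo; rewrite jo ltnn in lt_jk.
  have ltS (j : 'I_n) : (j < k.+1)%N -> j = o \/ (j < k)%N.
    by rewrite ltnS leq_eqVlt => /orP[/eqP jk|]; [left; exact: val_inj|right].
  exists Y'; split.
  - move=> j; rewrite /Y'; case: eqP => // _; apply: smooth_vfieldZ => //.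
    by apply: smooth_fun_powR => //; exact: smooth_inner.
  - move=> q Uq i j /ltS[->|lt_i] /ltS[->|lt_j].
    + by rewrite !Y'o innerZl innerZr rs // eqxx.
    + rewrite Y'o (Y'lt j) // innerZl ZY // mulr0.
      by case: eqP => // oj; rewrite -oj ltnn in lt_j.
    + rewrite Y'o (Y'lt i) // inner_sym innerZl ZY // mulr0.
      by case: eqP => // oj; rewrite oj ltnn in lt_i.
    + by rewrite !Y'lt // oY.
  - move=> q Uq j /ltS[->|lt_j]; last by rewrite Y'lt // YX.
    rewrite Y'o memvZ // memvD ?mem_flag //; apply: memv_suml => i lt_ik.
    apply: memvZ; apply: subvP (YX q Uq i lt_ik); apply/subv_sumP => l lt_li.
    by rewrite -memvE mem_flag //= ltnS ltnW // (leq_trans lt_li lt_ik).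
  - move=> q Uq j /ltS[->|lt_j]; last first.
      rewrite (eq_bigr (fun i => <[Y i q : 'rV[R]_n]>%VS)); first exact: XY.
      by move=> i lt_ij; rewrite Y'lt // (leq_trans lt_ij lt_j).
    have -> : X o q = (s q `^ (- 2^-1))^-1 *: (Y' o q : 'rV[R]_n) +
        \sum_(i < n | (i < k)%N) inner g (X o q) (Y i q) *: (Y' i q : 'rV[R]_n).
      rewrite Y'o scalerA mulVf ?r0 // scale1r /Z -addrA -big_split /=.
      rewrite big1 ?addr0 //.
      by move=> i lt_ik; rewrite Y'lt // -scalerDl mulN1r addNr scale0r.
    rewrite memvD //; first by rewrite memvZ // mem_flag.
    apply: memv_suml => i lt_ik; rewrite memvZ // mem_flag //=.
    by rewrite ltnS ltnW.
have [Y [sY oY YX XY]] := gs n (leqnn n).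
exists Y; split=> // [q Uq i j|q Uq r]; first exact: oY.
apply/eqP; rewrite eqEsubv; apply/andP; split; apply: flag_sub => j _.
  exact: XY q Uq j (ltn_ord j).
exact: YX q Uq j (ltn_ord j).
Qed.

(** Gram-Schmidt keeps every partial span, in particular those of length [\dim (H i q)]. At the top
    of the flag, [n] spanning vectors form a basis. *)
Lemma adapted_orthonormal_frame (g : metric N) U X : open U ->
  adapted_frame H U X ->
  exists2 Y, adapted_frame H U Y & orthonormal_frame g U Y.
Proof.
move=> oU [sX bX aX]; have [Y [sY oY XY]] := gram_schmidt g oU sX bX.
exists Y => //; split=> // q Uq; last first.
  by move=> i; exact: etrans (aX q Uq i) (XY q Uq _).
rewrite /is_basis basisEdim size_tuple dimvf /dim /= mul1n leqnn andbT.
have [s Hs] := grad_step H q; rewrite -Hs (etrans (aX q Uq s) (XY q Uq _)).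
apply/subv_sumP => j _; rewrite -memvE; apply: memv_span.
by apply/mapP; exists j; rewrite ?mem_enum.
Qed.

End Frames.

(** * Change of metric *)

Section Admissibility.
Variables (R : realType) (m n : nat) (M : manifold R m) (N : manifold R n).
Variables (H : gradation N) (Phi : M -> N).

(** A permutation term with no zero factor would make the total degree of [I] at least that of
    [J]. *)
Lemma det_block_triangular0 (dg : 'I_n -> nat) (d : nat) (B : 'M[R]_n)
    (I J : 'I_m -> 'I_n) :
  block_triangular dg B -> (\sum_(a < m) dg (I a) < \sum_(a < m) dg (J a))%N ->
  \det (\matrix_(a, b) B (I a) (J b)) = 0.
Proof.
move=> B0 ltIJ; rewrite /determinant big1 // => s _.
have [/existsP[a lt_a]|] := boolP [exists a, dg (I a) < dg (J (s a))]%N.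
  by rewrite (bigD1 a) //= mxE B0 // mul0r mulr0.
rewrite negb_exists => /forallP geJ; move: ltIJ.
rewrite ltnNge [X in (X <= _)%N](reindex_perm s) /=.
by rewrite leq_sum // => a _; rewrite leqNgt.
Qed.

Lemma is_basis_change (p : M) (E E' : 'I_m -> tangent p) : is_basis E ->
  exists C : 'M[R]_m,
    forall k, E' k = \sum_l C k l *: (E l : 'rV[R]_m).
Proof.
move=> bE; pose b := [tuple (E j : 'rV[R]_m) | j < m].
exists (\matrix_(k, l) coord b l (E' k)) => k.
rewrite {1}(coord_basis bE (memvf (E' k : 'rV[R]_m))).
by apply: eq_bigr => l _; rewrite mxE -tnth_nth tnth_mktuple.
Qed.

(** The degree at [p] comes with its own basis and adapted frame [Y]. Changing the basis multiplies
    the minor by a determinant; in the expansion along [Y] only indices of degree at most [d] occur,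
    and their pairing with a higher [J] vanishes. *)
Lemma minor_degree0 (d : nat) (g : metric N) (p : M) (E : 'I_m -> tangent p)
    U (X : 'I_n -> vfield N) (J : multi_index m n) :
  equiregular H -> immersion_degree Phi H d ->
  is_basis E -> U (Phi p) -> adapted_frame H U X -> orthonormal_frame g U X ->
  high (deg H (Phi p)) d (val J) ->
  \det (colsub (val J)
    (\matrix_(k, j) inner g (dmap Phi (E k)) (X j (Phi p)))) = 0.
Proof.
move=> eqH [degPhi _] bE Up aX oX hJ.
have [k [E0 [bE0 [U0 [Y [lambda [[_ U0p] aY eY ek]]]]]] le_kd] := degPhi p.
have [C eE] := is_basis_change E bE0.
rewrite (_ : \matrix_(k, j) _ = C *m
    \matrix_(k, j) inner g (dmap Phi (E0 k)) (X j (Phi p))); last first.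
  apply/matrixP => a j; rewrite !mxE eE {1}/dmap linear_sum inner_suml.
  by apply: eq_bigr => l _; rewrite linearZ innerZl mxE.
rewrite -mulmx_colsub det_mulmx.
have -> : \det (colsub (val J)
    (\matrix_(k, j) inner g (dmap Phi (E0 k)) (X j (Phi p)))) =
    inner_mvec g (Phi p) (wedge (fun k => dmap Phi (E0 k)))
      (wedge (fun b => X (val J b) (Phi p))).
  rewrite inner_mvec_wedge; congr (\det _).
  by apply/matrixP => a b; rewrite !mxE.
rewrite eY inner_mvec_suml big1 ?mulr0 // => I _.
have [->|lI] := eqVneq (lambda I) 0; first by rewrite mul0r.
rewrite inner_mvec_wedge.
pose B : 'M[R]_n := \matrix_(i, j) inner g (Y i (Phi p)) (X j (Phi p)).
rewrite (_ : \matrix_(a, b) _ = \matrix_(a, b) B (val I a) (val J b)).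
  rewrite (@det_block_triangular0 (deg H (Phi p)) d) ?mulr0 //.
    move=> i j lt_ij; rewrite mxE.
    exact: (adapted_orthogonal eqH aY aX U0p Up (oX _ Up) lt_ij).
  apply: leq_ltn_trans hJ; apply: leq_trans le_kd; rewrite ek.
  exact: (leq_bigmax_cond (F := deg_multi H (Phi p))).
by apply/matrixP => a b; rewrite !mxE.
Qed.

(** The inner products of the frame are constant on [U], so metric compatibility has zero left-hand
    side. *)
Lemma orthonormal_nabla_skew (g : metric N) (nabla : connection_op N) p
    U (X : 'I_n -> vfield N) (v : tangent p) i j :
  levi_civita g nabla -> open_nbhs p U -> (forall j, smooth_vfield U (X j)) ->
  orthonormal_frame g U X ->
  inner g (X i p) (nabla p v (X j)) = - inner g (nabla p v (X i)) (X j p).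
Proof.
move=> lc pU sX oX; have := lc_metric lc v pU (sX i) (sX j).
rewrite (dfun_near_cst v pU (c := (i == j)%:R)); last first.
  by move=> q Uq; exact: oX.
by move/eqP; rewrite eq_sym addrC addr_eq0 => /eqP.
Qed.

(** One implication suffices by symmetry in the two metrics. Admissibility asks for one frame and
    one basis at each point: the basis is kept and the frame orthonormalized for [g']. *)
Lemma admissible_transfer (d : nat) (g g' : metric N)
    (nabla nabla' : connection_op N) (V : field_along Phi) :
  equiregular H -> immersion_degree Phi H d ->
  levi_civita g nabla -> levi_civita g' nabla' ->
  admissible H d g nabla V -> admissible H d g' nabla' V.
Proof.
move=> eqH degPhi lc lc' admV p.
have [U [X [E [pU aX oX bE admE]]]] := admV p.
have [oU Up] := pU; have [sX _ _] := aX.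
have [Y aY oY] := adapted_orthonormal_frame g' oU aX; have [sY _ _] := aY.
exists U, Y, E; split=> // J hJ XJ; rewrite /XJ.
have lcC := lc_connection lc; have lcC' := lc_connection lc'.
have tf : torsion_free nabla by exact: lc_torsion_free lc.
have tf' : torsion_free nabla' by exact: lc_torsion_free lc'.
pose P := Phi p; pose dg := deg H P.
pose e k : 'rV[R]_n := dmap Phi (E k).
pose De k : 'rV[R]_n := nabla_along nabla V (E k).
pose De' k : 'rV[R]_n := nabla_along nabla' V (E k).
pose v : 'rV[R]_n := V p.
pose Xp j : 'rV[R]_n := X j P; pose Yp j : 'rV[R]_n := Y j P.
pose DX j : 'rV[R]_n := nabla P v (X j).
pose DX' j : 'rV[R]_n := nabla' P v (X j).
pose DY' j : 'rV[R]_n := nabla' P v (Y j).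
pose A := \matrix_(k, j) inner g (e k : tangent P) (X j P).
pose W := \matrix_(k, j) (inner g (De k : tangent P) (X j P) +
                          inner g (e k : tangent P) (nabla P v (X j))).
pose A' := \matrix_(k, j) inner g' (e k : tangent P) (Y j P).
pose W' := \matrix_(k, j) (inner g' (De' k : tangent P) (Y j P) +
                          inner g' (e k : tangent P) (nabla' P v (Y j))).
(* The transition coefficients are kept as functions on [N], since [T] consists of their derivatives
   along [V p]. *)
pose Qf j i (q : N) := inner g' (X j q) (Y i q).
pose Q := \matrix_(j, i) Qf j i P.
pose T := \matrix_(j, i) dfun (Qf j i) (V p).
have sQ j i : smooth_fun U (Qf j i) by exact: smooth_inner.
have Q0 q j i : U q -> (dg j < dg i)%N -> Qf j i q = 0.
  by move=> Uq lt_ji; exact: (adapted_orthogonal eqH aX aY Uq Uq (oY q Uq) lt_ji).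
have XE q j : U q -> X j q = \sum_i Qf j i q *: (Y i q : 'rV[R]_n).
  by move=> Uq; exact: orthonormal_expand (oY q Uq).
have eA k : e k = \sum_j A k j *: Xp j.
  rewrite {1}(orthonormal_expand (e k) (oX P Up)).
  by apply: eq_bigr => j _; rewrite mxE.
have AQ : A' = A *m Q.
  apply/matrixP => k i; rewrite !mxE eA inner_suml; apply: eq_bigr => j _.
  by rewrite innerZl [Q _ _]mxE.
have eA' k : e k = \sum_i A' k i *: Yp i.
  rewrite {1}(orthonormal_expand (e k) (oY P Up)).
  by apply: eq_bigr => i _; rewrite mxE.
pose w k : 'rV[R]_n := De k - \sum_j A k j *: DX j.
(* Here the connections are exchanged: in the same frame [X], both sides equal an expression free of
   any connection. *)
have wE k : w k = De' k - \sum_j A k j *: DX' j.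
  rewrite /w (nabla_along_sub V lcC tf pU sX (eA k)).
  by rewrite (nabla_along_sub V lcC' tf' pU sX (eA k)).
(* Skew-symmetry moves the derivative off [X j], turning the second term of [W] into the correction
   subtracted in [w k]. *)
have WE k j : W k j = inner g (w k : tangent P) (X j P).
  rewrite mxE innerBl; congr (_ + _); rewrite {1}eA !inner_suml -sumrN.
  apply: eq_bigr => i _; rewrite !innerZl -mulrN; congr (_ * _).
  exact: orthonormal_nabla_skew lc pU sX oX.
have W'E k i : W' k i =
    inner g' (De' k - \sum_l A' k l *: DY' l : tangent P) (Y i P).
  rewrite mxE innerBl; congr (_ + _); rewrite {1}eA' !inner_suml -sumrN.
  apply: eq_bigr => l _; rewrite !innerZl -mulrN; congr (_ * _).
  exact: orthonormal_nabla_skew lc' pU sY oY.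
have DXE j : DX' j = \sum_i (T j i *: Yp i + Q j i *: DY' i).
  rewrite /DX' (nabla_local lcC' (v : tangent P) pU (sX j) (XE ^~ j)).
  rewrite (nabla_sum lcC' (v : tangent P) _ pU (sQ j) sY).
  by apply: eq_bigr => i _; rewrite !mxE.
(* Passing from [X] to [Y] under [nabla'] leaves only the derivative of the transition matrix. *)
have w'E k : De' k - \sum_l A' k l *: DY' l =
    w k + \sum_i (A *m T) k i *: Yp i.
  rewrite wE -[RHS]addrA; congr (_ + _).
  have -> : \sum_j A k j *: DX' j =
      \sum_i (A *m T) k i *: Yp i + \sum_l A' k l *: DY' l.
    rewrite -big_split /=.
    transitivity (\sum_j \sum_i ((A k j * T j i) *: Yp i +
                                (A k j * Q j i) *: DY' i)).
      apply: eq_bigr => j _; rewrite DXE scaler_sumr; apply: eq_bigr => i _.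
      by rewrite scalerDr !scalerA.
    rewrite exchange_big; apply: eq_bigr => i _ /=.
    by rewrite big_split /= -!scaler_suml AQ !mxE.
  by rewrite opprD addrAC addNr add0r.
have WQ : W' = W *m Q + A *m T.
  apply/matrixP => k i; rewrite W'E w'E innerDl [RHS]mxE; congr (_ + _).
    rewrite {1}(orthonormal_expand (w k) (oX P Up)) inner_suml mxE.
    by apply: eq_bigr => j _; rewrite innerZl WE [Q _ _]mxE.
  rewrite inner_suml (bigD1 i) //= innerZl oY // eqxx mulr1 big1 ?addr0 //.
  by move=> l /negbTE ne_li; rewrite innerZl oY // ne_li mulr0.
rewrite (admissibility_dminor g' nabla' (V p) e De' Y J) -/A' -/W' AQ WQ.
apply/esym; apply: (dminor_change (dg := dg) (d := d)) => //.
- by move=> j i lt_ji; rewrite mxE Q0.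
(* [Qf j i] vanishes on all of [U], not only at [P], hence so does its derivative at [P]. *)
- move=> j i lt_ji; rewrite mxE; apply: (dfun_near_cst _ pU (c := 0)).
  by move=> q Uq; exact: Q0.
- by move=> I hI; exact: minor_degree0 eqH degPhi bE Up aX oX hI.
- by move=> I hI; rewrite -admissibility_dminor -(admE I hI).
Qed.

End Admissibility.

Theorem proposition6p4 (R : realType) (m n : nat)
    (M : manifold R m) (N : manifold R n) (H : gradation N)
    (Phi : M -> N) (d : nat) (g g' : metric N) (nabla nabla' : connection_op N)
    (V : field_along Phi) :
  equiregular H -> immersion Phi -> immersion_degree Phi H d ->
  levi_civita g nabla -> levi_civita g' nabla' ->
  compact_smooth_along V ->
  (admissible H d g nabla V <-> admissible H d g' nabla' V).
Proof.
by move=> eqH _ degPhi lc lc' _; split; exact: admissible_transfer.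
Qed.
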